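(* Let $K$ be a field of characteristic $0$ and let $\mathfrak{R}=(R_0=1,R_1,R_2,\dots)$ be a sequence of symmetric functions over $K$ in the variables $\boldsymbol{x}=(x_1,x_2,\dots)$, where $R_n$ is homogeneous of degree $n$. Put $\mathcal{A}(t)=\sum_{n\geq 0}R_nt^n$. The following five conditions are equivalent. (a) $\mathfrak{R}$ is a sprout sequence, i.e. there is a power series $F(t)=\sum_{n\ge0}a_nt^n\in K[[t]]$ with $a_0=1$ such that $\mathcal{A}(t)=\prod_{i\geq 1}F(x_it)$. (b) There exist $b_1,b_2,\dots\in K$ such that $\log \mathcal{A}(t)=\sum_{n\geq 1} b_np_n\frac{t^n}{n}$. (c) There exist $a_0=1,a_1,a_2,\dots\in K$ such that for all $n\geq 1$, $R_n=\sum_{\lambda\vdash n}a_{\lambda_1}a_{\lambda_2}\cdots m_\lambda$. (d) There exist $b_1,b_2,\dots\in K$ such that for all $n\geq 1$, $R_n=\sum_{\lambda\vdash n}z_\lambda^{-1}b_{\lambda_1}b_{\lambda_2}\cdots p_\lambda$. (e) For all $f,g\in\hat{\Lambda}_K$ we have $\mathcal{A}(t)*(fg)=(\mathcal{A}(t)*f)(\mathcal{A}(t)*g)$; equivalently, $f\mapsto f*\mathcal{A}(t)$ is an algebra homomorphism. Moreover, when these hold with seed $F(t)$ as in (a), the constants in (c) are the coefficients of $F$, i.e. $F(t)=\sum_{n\ge0}a_nt^n$, and the constants in (b) and (d) are given by $\log F(t)=\sum_{n\geq 1}b_n\frac{t^n}{n}$.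
   Context: $\Lambda_K$ is the $K$-algebra of symmetric functions in $\boldsymbol{x}$; $m_\lambda$, $p_\lambda=p_{\lambda_1}p_{\lambda_2}\cdots$ denote monomial and power-sum symmetric functions; $p_n=\sum_i x_i^n$. For $\lambda=\langle 1^{m_1},2^{m_2},\dots\rangle$ (i.e. $\lambda$ has $m_i$ parts equal to $i$), $z_\lambda=1^{m_1}m_1!\,2^{m_2}m_2!\cdots$. $\hat{\Lambda}_K$ is the set of symmetric formal power series over $K$ in $\boldsymbol{x}$. The internal (Kronecker) product $*$ is the bilinear (continuous) product with $p_\lambda*p_\mu=\delta_{\lambda\mu}z_\lambda p_\lambda$, extended coefficientwise in $t$ (so $\mathcal{A}(t)*f=\sum_n (R_n*f)t^n$). *)

(* Defs.v *)
From HB Require Import structures.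
From mathcomp Require Import all_boot all_order all_algebra.
From mathcomp Require Import finmap monalg.
From mathcomp Require Import boolp classical_sets functions cardinality fsbigop.

Set Implicit Arguments.
Unset Strict Implicit.
Unset Printing Implicit Defensive.

Import GRing.Theory.

Local Open Scope classical_set_scope.
Local Open Scope ring_scope.

(* K[[x_0, x_1, ...]]: arbitrary coefficient families on the monomials
   {cmonom nat} (finitely supported exponent functions nat -> nat); the
   variables are indexed from 0. *)
Record xps (K : Type) := XPS { xcoef : {cmonom nat} -> K }.

(* R[[t]] for a commutative K-algebra R; K[[t]] is tps K^o. *)
Record tps (K : comNzRingType) (R : comAlgType K) := TPS { tcoef : nat -> R }.

Section XpsRing.
Variable K : comNzRingType.
Implicit Types (f g h : xps K) (m d e : {cmonom nat}) (a b : K).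

Lemma xcoef_inj : injective (@xcoef K).
Proof. by case=> f [g] /= ->. Qed.

Lemma xpsP f g : (forall m, xcoef f m = xcoef g m) -> f = g.
Proof. by move=> fg; apply: xcoef_inj; apply: funext. Qed.

HB.instance Definition _ := gen_eqMixin (xps K).
HB.instance Definition _ := gen_choiceMixin (xps K).

Definition xps_zero : xps K := XPS (fun=> 0).
Definition xps_opp f : xps K := XPS (fun m => - xcoef f m).
Definition xps_add f g : xps K := XPS (fun m => xcoef f m + xcoef g m).
Definition xps_scale a f : xps K := XPS (fun m => a * xcoef f m).
Definition xps_one : xps K := XPS (fun m => (m == mone)%:R).

(* The factorizations of a monomial form a finite set (finite_factor). *)
Definition xps_mul f g : xps K :=
  XPS (fun m => \sum_(d \in [set d : {cmonom nat} * {cmonom nat}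
                               | mmul d.1 d.2 = m]) xcoef f d.1 * xcoef g d.2).

Fact xps_addA : associative xps_add.
Proof. by move=> f g h; apply: xpsP => m /=; rewrite addrA. Qed.
Fact xps_addC : commutative xps_add.
Proof. by move=> f g; apply: xpsP => m /=; rewrite addrC. Qed.
Fact xps_add0 : left_id xps_zero xps_add.
Proof. by move=> f; apply: xpsP => m /=; rewrite add0r. Qed.
Fact xps_addN : left_inverse xps_zero xps_opp xps_add.
Proof. by move=> f; apply: xpsP => m /=; rewrite addNr. Qed.

HB.instance Definition _ :=
  GRing.isZmodule.Build (xps K) xps_addA xps_addC xps_add0 xps_addN.

Definition cmdivs m : seq {cmonom nat} :=
  undup [seq mkcmonom [fsfun i : finsupp m => val (g i) | 0%N]
        | g : {ffun finsupp m -> 'I_(mdeg m).+1}].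

Lemma leq_mdeg m i : (m i <= mdeg m)%N.
Proof.
have [mi|mi] := boolP (i \in finsupp m); last first.
  by move: mi; rewrite -cmE_eq0 => /eqP->.
by rewrite mdegE (big_fsetD1 i) //= leq_addr.
Qed.

Lemma mem_cmdivs m d e : mmul d e = m -> d \in cmdivs m.
Proof.
move=> dem; rewrite mem_undup.
have le i : (d i <= m i)%N by rewrite -dem cmM leq_addr.
apply/mapP; exists [ffun i : finsupp m => inord (d (val i))].
  by rewrite mem_enum.
apply/eqP/cmP => i; rewrite cmE /= fsfun_ffun.
case: insubP => [u _ ui|].
  rewrite /= ffunE -ui inordK //.
  by rewrite ltnS; apply: (leq_trans (le _)); exact: leq_mdeg.
by rewrite -cmE_eq0 => /eqP mi; apply/eqP; rewrite -leqn0 -[X in (_ <= X)%N]mi.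
Qed.

Lemma finite_factor m :
  finite_set [set d : {cmonom nat} * {cmonom nat} | mmul d.1 d.2 = m].
Proof.
apply: (@sub_finite_set _ _
  [set` [seq (d, e) | d <- cmdivs m, e <- cmdivs m]]); last exact: finite_seq.
move=> [d e] /= dem; apply/allpairsP; exists (d, e); split=> //=.
  exact: mem_cmdivs dem.
by apply: (@mem_cmdivs _ _ d); rewrite mulmC.
Qed.

Lemma xcoefM (D : seq {cmonom nat}) f g m : uniq D ->
  (forall d e, mmul d e = m -> d \in D) ->
  xcoef (xps_mul f g) m =
  \sum_(d <- D) \sum_(e <- D | mmul d e == m) xcoef f d * xcoef g e.
Proof.
move=> uD mD /=.
pose r := [seq p <- [seq (d, e) | d <- D, e <- D] | mmul p.1 p.2 == m].
have ur : uniq r.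
  by apply/filter_uniq/allpairs_uniq => //= -[? ?] [? ?] _ _ [-> ->].
have mem_r p : (p \in r) = (mmul p.1 p.2 == m).
  rewrite mem_filter; case: eqP => //= pm.
  apply/allpairsP; exists p; split; last by case: p pm.
    exact: mD pm.
  by apply: (mD _ p.1); rewrite mulmC.
rewrite (_ : [set d | _] = [set` r]); last first.
  by apply/seteqP; split=> p /=; rewrite mem_r => /eqP.
rewrite -fsbig_seq // big_filter big_mkcond big_allpairs_dep /=.
by apply: eq_bigr => d _; rewrite [RHS]big_mkcond.
Qed.

Lemma cmdivs_uniq m : uniq (cmdivs m). Proof. exact: undup_uniq. Qed.

Fact xps_mulC : commutative xps_mul.
Proof.
move=> f g; apply: xpsP => m.
have cD := @mem_cmdivs m; rewrite !(xcoefM _ _ (cmdivs_uniq m) cD).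
under eq_bigr do rewrite big_mkcond /=.
rewrite exchange_big /=; apply: eq_bigr => d _.
by rewrite [RHS]big_mkcond /=; apply: eq_bigr => e _; rewrite mulmC mulrC.
Qed.

Lemma xps_mul3 f g h m (D := cmdivs m) :
  xcoef (xps_mul f (xps_mul g h)) m =
  \sum_(a <- D) \sum_(b <- D) \sum_(c <- D | mmul a (mmul b c) == m)
    xcoef f a * xcoef g b * xcoef h c.
Proof.
have cD := @mem_cmdivs m; have uD := cmdivs_uniq m.
rewrite (xcoefM _ _ uD cD); apply: eq_bigr => a _.
transitivity (\sum_(e <- D | mmul a e == m) \sum_(b <- D)
   \sum_(c <- D | mmul b c == e) xcoef f a * xcoef g b * xcoef h c).
  apply: eq_bigr => e /eqP ae; rewrite (xcoefM _ _ uD) => [|d d' dd']; last first.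
    by apply: (cD _ (mmul d' a)); rewrite mulmA dd' mulmC.
  rewrite mulr_sumr; apply: eq_bigr => b _.
  by rewrite mulr_sumr; apply: eq_bigr => c _; rewrite mulrA.
rewrite exchange_big /=; apply: eq_bigr => b _.
rewrite (exchange_big_dep xpredT) //= [RHS]big_mkcond /=; apply: eq_bigr => c _.
case: eqP => [abc|abc].
  have bcD : mmul b c \in D by apply: (cD _ a); rewrite mulmC.
  rewrite big_mkcond (bigD1_seq (mmul b c)) //= abc !eqxx big1 ?addr0 // => e.
  by rewrite eq_sym => /negPf->; rewrite andbF.
by rewrite big1 // => e /andP[/eqP ae /eqP be]; case: abc; rewrite be.
Qed.

Fact xps_mulA : associative xps_mul.
Proof.
move=> f g h; rewrite [RHS]xps_mulC; apply: xpsP => m.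
rewrite !xps_mul3 [RHS]exchange_big /=; apply: eq_bigr => a _.
under eq_bigr do rewrite big_mkcond /=.
under [in RHS]eq_bigr do rewrite big_mkcond /=.
rewrite [RHS]exchange_big; apply: eq_bigr => b _; apply: eq_bigr => c _ /=.
by rewrite [mmul c _]mulmC -mulmA [_ * xcoef f a]mulrC mulrAC.
Qed.

Fact xps_mul1 : left_id xps_one xps_mul.
Proof.
move=> f; apply: xpsP => m.
have cD := @mem_cmdivs m; have uD := cmdivs_uniq m.
rewrite (xcoefM _ _ uD cD) (bigD1_seq mone) //=; last first.
  by apply: (cD _ m); rewrite mul1m.
rewrite [X in _ + X]big1 ?addr0 => [|d /negPf d1]; last first.
  by rewrite big1 // => e _; rewrite d1 mul0r.
under eq_bigl do rewrite mul1m.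
by rewrite -big_filter filter_pred1_uniq ?big_seq1 ?eqxx ?mul1r //;
   apply: (cD _ mone); rewrite mulm1.
Qed.

Fact xps_mulDl : left_distributive xps_mul +%R.
Proof.
move=> f g h; apply: xpsP => m /=; rewrite -fsbig_split; last exact: finite_factor.
by apply: eq_fsbigr => d _; rewrite mulrDl.
Qed.

Fact xps_one_neq0 : xps_one != 0.
Proof.
apply/eqP => /(congr1 (fun f => xcoef f mone)) /= /eqP.
by rewrite eqxx oner_eq0.
Qed.

HB.instance Definition _ := GRing.Zmodule_isComNzRing.Build (xps K)
  xps_mulA xps_mulC xps_mul1 xps_mulDl xps_one_neq0.

Fact xps_scaleA a b f : xps_scale a (xps_scale b f) = xps_scale (a * b) f.
Proof. by apply: xpsP => m /=; rewrite mulrA. Qed.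
Fact xps_scale1 : left_id 1 xps_scale.
Proof. by move=> f; apply: xpsP => m /=; rewrite mul1r. Qed.
Fact xps_scaleDr : right_distributive xps_scale +%R.
Proof. by move=> a f g; apply: xpsP => m /=; rewrite mulrDr. Qed.
Fact xps_scaleDl f : {morph xps_scale^~ f : a b / a + b}.
Proof. by move=> a b; apply: xpsP => m /=; rewrite mulrDl. Qed.

HB.instance Definition _ := GRing.Zmodule_isLmodule.Build K (xps K)
  xps_scaleA xps_scale1 xps_scaleDr xps_scaleDl.

Fact xps_scaleAl a f g : a *: (f * g) = (a *: f) * g.
Proof.
apply: xpsP => m; have cD := @mem_cmdivs m; have uD := cmdivs_uniq m.
rewrite -[RHS]/(xcoef (xps_mul _ g) m) [RHS](xcoefM _ _ uD cD).
rewrite -[LHS]/(a * xcoef (xps_mul f g) m) (xcoefM _ _ uD cD) mulr_sumr.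
apply: eq_bigr => d _; rewrite mulr_sumr; apply: eq_bigr => e _.
by rewrite mulrA.
Qed.

HB.instance Definition _ :=
  GRing.Lmodule_isLalgebra.Build K (xps K) xps_scaleAl.
HB.instance Definition _ := GRing.Lalgebra_isComAlgebra.Build K (xps K).

End XpsRing.

Section TpsRing.
Variables (K : comNzRingType) (R : comAlgType K).
Implicit Types (A B C : tps R) (a b : K).

Lemma tcoef_inj : injective (@tcoef K R).
Proof. by case=> f [g] /= ->. Qed.

Lemma tpsP A B : (forall n, tcoef A n = tcoef B n) -> A = B.
Proof. by move=> AB; apply: tcoef_inj; apply: funext. Qed.

HB.instance Definition _ := gen_eqMixin (tps R).
HB.instance Definition _ := gen_choiceMixin (tps R).

Definition tps_zero : tps R := TPS (fun=> 0).
Definition tps_opp A : tps R := TPS (fun n => - tcoef A n).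
Definition tps_add A B : tps R := TPS (fun n => tcoef A n + tcoef B n).
Definition tps_scale a A : tps R := TPS (fun n => a *: tcoef A n).
Definition tps_one : tps R := TPS (fun n => (n == 0)%:R).
Definition tps_mul A B : tps R :=
  TPS (fun n => \sum_(j < n.+1) tcoef A j * tcoef B (n - j)).

Fact tps_addA : associative tps_add.
Proof. by move=> A B C; apply: tpsP => n /=; rewrite addrA. Qed.
Fact tps_addC : commutative tps_add.
Proof. by move=> A B; apply: tpsP => n /=; rewrite addrC. Qed.
Fact tps_add0 : left_id tps_zero tps_add.
Proof. by move=> A; apply: tpsP => n /=; rewrite add0r. Qed.
Fact tps_addN : left_inverse tps_zero tps_opp tps_add.
Proof. by move=> A; apply: tpsP => n /=; rewrite addNr. Qed.

HB.instance Definition _ :=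
  GRing.isZmodule.Build (tps R) tps_addA tps_addC tps_add0 tps_addN.

Fact tps_mulC : commutative tps_mul.
Proof.
move=> A B; apply: tpsP => n /=; rewrite (reindex_inj rev_ord_inj) /=.
by apply: eq_bigr => j _; rewrite mulrC subSS subKn // -ltnS.
Qed.

Lemma tcoefM_rev A B n :
  tcoef (tps_mul A B) n = \sum_(j < n.+1) tcoef A (n - j) * tcoef B j.
Proof. by rewrite tps_mulC /=; apply: eq_bigr => j _; rewrite mulrC. Qed.

Fact tps_mulA : associative tps_mul.
Proof.
move=> A B C; apply: tpsP => n; rewrite [RHS]tcoefM_rev /=.
pose coef3 j k := tcoef A j * (tcoef B (n - j - k)%N * tcoef C k).
transitivity (\sum_(j < n.+1) \sum_(k < n.+1 | (k <= n - j)%N) coef3 j k).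
  apply: eq_bigr => /= j _; rewrite -[X in _ * X]/(tcoef (tps_mul B C) (n - j)) tcoefM_rev mulr_sumr.
  by rewrite (big_ord_narrow_leq (leq_subr _ _)).
rewrite (exchange_big_dep predT) //=; apply: eq_bigr => k _.
transitivity (\sum_(j < n.+1 | (j <= n - k)%N) coef3 j k).
  apply: eq_bigl => j; rewrite -ltnS -(ltnS j) -!subSn ?leq_ord //.
  by rewrite -subn_gt0 -(subn_gt0 j) -!subnDA addnC.
rewrite (big_ord_narrow_leq (leq_subr _ _)) mulr_suml /=.
by apply: eq_bigr => j _; rewrite /coef3 -!subnDA addnC mulrA.
Qed.

Fact tps_mul1 : left_id tps_one tps_mul.
Proof.
move=> A; apply: tpsP => n /=; rewrite big_ord_recl /= subn0 mul1r.
by rewrite big1 ?addr0 // => i _; rewrite mul0r.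
Qed.

Fact tps_mulDl : left_distributive tps_mul +%R.
Proof.
move=> A B C; apply: tpsP => n /=; rewrite -big_split.
by apply: eq_bigr => j _; rewrite mulrDl.
Qed.

Fact tps_one_neq0 : tps_one != 0.
Proof.
apply/eqP => /(congr1 (fun A => tcoef A 0)) /= /eqP.
by rewrite oner_eq0.
Qed.

HB.instance Definition _ := GRing.Zmodule_isComNzRing.Build (tps R)
  tps_mulA tps_mulC tps_mul1 tps_mulDl tps_one_neq0.

Fact tps_scaleA a b A : tps_scale a (tps_scale b A) = tps_scale (a * b) A.
Proof. by apply: tpsP => n /=; rewrite scalerA. Qed.
Fact tps_scale1 : left_id 1 tps_scale.
Proof. by move=> A; apply: tpsP => n /=; rewrite scale1r. Qed.
Fact tps_scaleDr : right_distributive tps_scale +%R.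
Proof. by move=> a A B; apply: tpsP => n /=; rewrite scalerDr. Qed.
Fact tps_scaleDl A : {morph tps_scale^~ A : a b / a + b}.
Proof. by move=> a b; apply: tpsP => n /=; rewrite scalerDl. Qed.

HB.instance Definition _ := GRing.Zmodule_isLmodule.Build K (tps R)
  tps_scaleA tps_scale1 tps_scaleDr tps_scaleDl.

Fact tps_scaleAl a A B : a *: (A * B) = (a *: A) * B.
Proof.
apply: tpsP => n /=; rewrite scaler_sumr.
by apply: eq_bigr => j _; rewrite scalerAl.
Qed.

HB.instance Definition _ :=
  GRing.Lmodule_isLalgebra.Build K (tps R) tps_scaleAl.
HB.instance Definition _ := GRing.Lalgebra_isComAlgebra.Build K (tps R).

End TpsRing.

Section Series.
Variables (K : fieldType) (R : comAlgType K).

(* log A = sum_(k >= 1) (-1)^(k-1) (A - 1)^k / k for a series A with constant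
   term 1; then (A - 1)^k has no term in t^n for k > n. *)
Definition tlog (A : tps R) : tps R :=
  TPS (fun n => tcoef
    (\sum_(1 <= k < n.+1) ((-1) ^+ k.-1 / k%:R : K) *: (A - 1) ^+ k) n).

(* sum_(n >= 1) u_n t^n / n *)
Definition divn_series (u : nat -> R) : tps R :=
  TPS (fun n => if n is 0 then 0 else (n%:R^-1 : K) *: u n).

End Series.

(* Integer partitions: nonincreasing sequences of positive integers. *)
Record intpart := IntPart {
  parts :> seq nat;
  _ : sorted geq parts && (0%N \notin parts)
}.

HB.instance Definition _ := [isSub for parts].
HB.instance Definition _ := [Choice of intpart by <:].

Definition zpart (lam : intpart) : nat :=
  (\prod_(i <- undup lam) (i ^ count_mem i lam * (count_mem i lam)`!))%N.

Section SymmetricFunctions.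
Variable K : fieldType.
Implicit Types (f g : xps K) (lam : intpart).

Definition symmetric_series f : Prop :=
  forall s : nat -> nat, bijective s ->
  forall m m' : {cmonom nat}, (forall i, m' i = m (s i)) ->
  xcoef f m' = xcoef f m.

Definition homogeneous (n : nat) f : Prop :=
  forall m, xcoef f m != 0 -> mdeg m = n.

Definition symmetric_function f : Prop :=
  symmetric_series f /\
  exists N, forall m, xcoef f m != 0 -> (mdeg m <= N)%N.

Definition xvar (i : nat) : xps K := XPS (fun m => (m == ucm i)%:R).

(* Coefficientwise sum of a family in which every monomial occurs in only
   finitely many members. *)
Definition xsum (T : choiceType) (F : T -> xps K) : xps K :=
  XPS (fun m => \sum_(i \in [set: T]) xcoef (F i) m).

(* Used for n >= 1 only. *)
Definition psym (n : nat) : xps K := xsum (fun i => xvar i ^+ n).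

Definition psym_part lam : xps K := \prod_(i <- lam) psym i.

(* The sum of the distinct monomials whose nonzero exponents, in some order,
   are the parts of lam. *)
Definition msym_part lam : xps K :=
  XPS (fun m => (perm_eq [seq m i | i <- finsupp m] lam)%:R).

Definition psym_series (c : intpart -> K) : xps K :=
  xsum (fun lam => c lam *: psym_part lam).

(* In characteristic 0 every symmetric series f is psym_series c for a unique
   c; this is that c. *)
Definition psym_coord f : intpart -> K :=
  xget (fun=> 0) [set c | f = psym_series c].

(* Bilinear, continuous extension of p_lam * p_mu = delta_{lam,mu} z_lam p_lam *)
Definition intprod f g : xps K :=
  psym_series (fun lam => (zpart lam)%:R * psym_coord f lam * psym_coord g lam).

(* A(t) * f and f * A(t) *)
Definition tintprodl (A : tps (xps K)) f : tps (xps K) :=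
  TPS (fun n => intprod (tcoef A n) f).
Definition tintprodr f (A : tps (xps K)) : tps (xps K) :=
  TPS (fun n => intprod f (tcoef A n)).

(* phi restricted to the symmetric series is a K-algebra homomorphism *)
Definition sym_alg_morphism (phi : xps K -> tps (xps K)) : Prop :=
  [/\ phi 1 = 1,
      forall (c : K) f g, symmetric_series f -> symmetric_series g ->
        phi (c *: f + g) = c *: phi f + phi g
    & forall f g, symmetric_series f -> symmetric_series g ->
        phi (f * g) = phi f * phi g].

(* F(x_i t) *)
Definition subst_xt (F : tps K^o) (i : nat) : tps (xps K) :=
  TPS (fun n => (tcoef F n : K) *: xvar i ^+ n).

(* A = prod_(i >= 0) G i: each coefficient of the partial products is
   eventually constant, with value that of A. *)
Definition is_infprod (G : nat -> tps (xps K)) (A : tps (xps K)) : Prop :=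
  forall n m, exists N0, forall N, (N0 <= N)%N ->
  xcoef (tcoef (\prod_(i < N) G i) n) m = xcoef (tcoef A n) m.

Definition is_seed (F : tps K^o) (A : tps (xps K)) : Prop :=
  tcoef F 0 = 1 /\ is_infprod (subst_xt F) A.

Definition log_expansion (A : tps (xps K)) (b : nat -> K) : Prop :=
  tlog A = divn_series (fun n => b n *: psym n).

Definition monomial_expansion (R : nat -> xps K) (a : nat -> K) : Prop :=
  a 0%N = 1 /\ forall n, (1 <= n)%N ->
  R n = \sum_(lam \in [set lam : intpart | sumn lam = n])
          (\prod_(i <- lam) a i) *: msym_part lam.

Definition powersum_expansion (R : nat -> xps K) (b : nat -> K) : Prop :=
  forall n, (1 <= n)%N ->
  R n = \sum_(lam \in [set lam : intpart | sumn lam = n])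
          ((zpart lam)%:R^-1 * \prod_(i <- lam) b i) *: psym_part lam.

End SymmetricFunctions.

(* Main.v *)
Require Import Defs.
From HB Require Import structures.
From mathcomp Require Import all_boot all_order all_algebra.
From mathcomp Require Import finmap monalg.
From mathcomp Require Import boolp classical_sets functions cardinality fsbigop.

Import GRing.Theory.
Local Open Scope ring_scope.

Set Implicit Arguments.
Unset Strict Implicit.
Unset Printing Implicit Defensive.

(* Everything is reduced to Newton's recursion
     n R_n = sum_(1 <= k <= n) b_k p_k R_(n-k),
   which determines the sequence R from b, and b from R.  Applying t d/dt shows
   that it says log A(t) = sum_n b_n p_n t^n / n.  It is satisfied by
   sum_(lam |- n) z_lam^-1 b_lam p_lam because z_(lam + k) = k (m_k + 1) z_lam,
   and by the series whose coefficient at x^m is prod_i a_(m_i), that is, by the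
   coefficients of prod_i F(x_i t), as soon as n a_n = sum_k b_k a_(n-k), i.e.
   log F(t) = sum_n b_n t^n / n.

   For the internal product, p_lam is an eigenvector of f |-> R_n * f with
   eigenvalue z_lam times the p_lam-coordinate of R_n, so multiplicativity of
   A(t) * f amounts to multiplicativity of these eigenvalues in lam.  This uses
   that the p_lam form a topological basis of the symmetric series, which holds
   because p_lam is triangular in the m_mu with respect to the number of
   parts. *)

(** * Logarithms of power series in t *)

Lemma natr_neq0 (K : fieldType) (charK : [pchar K] =i pred0) n :
  (0 < n)%N -> n%:R != 0 :> K.
Proof. by move=> n0; rewrite (pcharf0P K).1 // -lt0n. Qed.

Section Logarithm.
Variables (K : fieldType) (R : comAlgType K).
Implicit Types (A B : tps R) (u v : nat -> R).

Lemma tcoefM A B n :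
  tcoef (A * B) n = \sum_(j < n.+1) tcoef A j * tcoef B (n - j).
Proof. by []. Qed.

Lemma tcoef_sum (I : Type) (r : seq I) (P : pred I) (F : I -> tps R) n :
  tcoef (\sum_(i <- r | P i) F i) n = \sum_(i <- r | P i) tcoef (F i) n.
Proof. exact: (big_morph (fun A => tcoef A n)). Qed.

(** The Euler operator [t d/dt]. Unlike [d/dt] it does not shift indices, and it is still a
    derivation. *)
Definition tder A : tps R := TPS (fun n => n%:R *: tcoef A n).

Lemma tderM A B : tder (A * B) = tder A * B + A * tder B.
Proof.
apply: tpsP => n; rewrite /= scaler_sumr -big_split; apply: eq_bigr => j _ /=.
rewrite -scalerAl -scalerAr -scalerDl -natrD subnKC //.
by rewrite -ltnS ltn_ord.
Qed.

Lemma tderD A B : tder (A + B) = tder A + tder B.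
Proof. by apply: tpsP => n /=; rewrite scalerDr. Qed.

Lemma tderZ (c : K) A : tder (c *: A) = c *: tder A.
Proof. by apply: tpsP => n /=; rewrite !scalerA mulrC. Qed.

Lemma tder_sum (I : Type) (r : seq I) (P : pred I) (F : I -> tps R) :
  tder (\sum_(i <- r | P i) F i) = \sum_(i <- r | P i) tder (F i).
Proof.
apply: (big_morph tder tderD); apply: tpsP => n /=; exact: scaler0.
Qed.

Lemma tderX A k : tder (A ^+ k.+1) = k.+1%:R *: (A ^+ k * tder A).
Proof.
elim: k => [|k IH]; first by rewrite expr0 mul1r scale1r.
rewrite exprS tderM IH -scalerAr mulrA -exprS [tder A * _]mulrC.
by rewrite -[X in X + _]scale1r -scalerDl nat1r.
Qed.

Lemma tcoef_expr_lt A k n : tcoef A 0 = 0 -> (n < k)%N -> tcoef (A ^+ k) n = 0.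
Proof.
move=> A0; elim: k n => // k IH n; rewrite ltnS => nk.
rewrite exprS tcoefM big_ord_recl A0 mul0r add0r big1 // => i _.
rewrite IH ?mulr0 //= /bump /= add1n.
case: n nk i => [|n] nk i; first by case: i.
by rewrite subSS; apply: leq_ltn_trans (leq_subr _ _) nk.
Qed.

(** The sum in [tlog] is cut off at the index of the coefficient being read. Since [(A - 1) ^+ k]
    starts at [t^k], a longer sum gives the same value, so one truncation serves all coefficients up
    to [N]. *)
Lemma tcoef_tlog A n N : tcoef A 0 = 1 -> (n <= N)%N ->
  tcoef (tlog A) n =
  tcoef (\sum_(1 <= k < N.+1) ((-1) ^+ k.-1 / k%:R : K) *: (A - 1) ^+ k) n.
Proof.
move=> A0 nN; rewrite [LHS]/= !tcoef_sum [RHS](big_cat_nat (n := n.+1)) //=.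
rewrite [X in _ = _ + X]big_nat_cond.
rewrite [X in _ = _ + X]big1 ?addr0 // => k /andP[/andP[nk _] _] /=.
by rewrite tcoef_expr_lt ?scaler0 //= A0 subrr.
Qed.

Lemma sign_scale k A : ((-1) ^+ k : K) *: A = (-1) ^+ k * A.
Proof.
elim: k => [|k IH]; first by rewrite scale1r mul1r.
by rewrite exprS -scalerA IH scaleN1r exprS mulN1r mulNr.
Qed.

Hypothesis charK : [pchar K] =i pred0.

(** Differentiating the truncated logarithm gives a geometric sum in [1 - A] times [tder A].
    Multiplying by [A = 1 - (1 - A)] telescopes it to [tder A] minus [(1 - A) ^+ n.+1 * tder A], and
    the latter has no term in [t^n]. *)
Lemma tder_tlog A : tcoef A 0 = 1 -> A * tder (tlog A) = tder A.
Proof.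
move=> A0; have B0 : tcoef (A - 1) 0 = 0 by rewrite /= A0 subrr.
apply: tpsP => n; pose LN := \sum_(1 <= k < n.+2)
  ((-1) ^+ k.-1 / k%:R : K) *: (A - 1) ^+ k.
transitivity (tcoef (A * tder LN) n).
  rewrite !tcoefM; apply: eq_bigr => j _; congr (_ * _) => /=.
  rewrite -/(tcoef _ _); congr (_ *: _); apply: (tcoef_tlog A0).
  exact: leq_trans (leq_subr _ _) _.
have -> : tder LN = (\sum_(k < n.+1) (1 - A) ^+ k) * tder A.
  rewrite /LN tder_sum big_add1 /= big_mkord mulr_suml; apply: eq_bigr => k _.
  have tB : tder (A - 1) = tder A.
    by apply: tpsP => -[|i] /=; rewrite ?scale0r ?subr0.
  rewrite tderZ tderX scalerA tB mulfVK ?natr_neq0 //.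
  by rewrite sign_scale mulrA -exprNn opprB.
have -> : A * ((\sum_(k < n.+1) (1 - A) ^+ k) * tder A) =
    tder A - (1 - A) ^+ n.+1 * tder A.
  rewrite mulrA -{2}[tder A]mul1r -mulrBl; congr (_ * _).
  apply: oppr_inj; rewrite opprB subrX1 -mulNr; congr (_ * _).
  by rewrite addrAC subrr add0r.
rewrite -[LHS]/(tcoef _ n - tcoef _ n) tcoefM big1 ?subr0 // => i _.
by rewrite tcoef_expr_lt ?mul0r //= A0 subrr.
Qed.

(* The recursion is the coefficientwise form of t A'(t) = A(t) * t L'(t) with
   L(t) = sum_(n >= 1) u_n t^n / n. *)
Definition newton_rec u v := forall n,
  n%:R *: v n = \sum_(k < n) u k.+1 * v (n - k.+1)%N.

(** In characteristic 0 the factor [n] can be cancelled, so each value at [n > 0] is computed from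
    the earlier ones. *)
Lemma newton_rec_uniqr u v w :
  v 0%N = w 0%N -> newton_rec u v -> newton_rec u w -> v =1 w.
Proof.
move=> vw0 nv nw n; elim/ltn_ind: n => -[//|n] IH.
apply: (scalerI (natr_neq0 charK (ltn0Sn n))); rewrite nv nw.
by apply: eq_bigr => k _; rewrite IH // subSS ltnS leq_subr.
Qed.

(** In the equation at [n.+1] the last summand is [u n.+1 * v 0 = u n.+1], and the others contain
    only earlier values of [u]. *)
Lemma newton_rec_uniql u u' v : v 0%N = 1 ->
  newton_rec u v -> newton_rec u' v -> forall n, u n.+1 = u' n.+1.
Proof.
move=> v0 nu nu'; elim/ltn_ind=> n IH.
have := nu n.+1; rewrite nu' !big_ord_recr /= subnn v0 !mulr1 => E.
apply/esym; move: E; rewrite (eq_bigr (fun k : 'I_n => u k.+1 * v (n.+1 - k.+1)%N)).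
  exact: addrI.
by move=> k _; rewrite IH.
Qed.

(** By [tder_tlog] the coefficients [l] of [tder (tlog A)] satisfy the recursion; uniqueness of the
    first argument identifies them with [u]. The algebra is arbitrary so that the lemma applies both
    to [A(t)] and to its seed. *)
Lemma tlogP A u : tcoef A 0 = 1 ->
  tlog A = divn_series u <-> newton_rec u (tcoef A).
Proof.
move=> A0; pose l n := n%:R *: tcoef (tlog A) n.
have nl : newton_rec l (tcoef A).
  move=> n; rewrite -[LHS]/(tcoef (tder A) n) -tder_tlog // mulrC tcoefM.
  by rewrite big_ord_recl /= scale0r mul0r add0r.
have E n : (n.+1%:R^-1 : K) *: l n.+1 = tcoef (tlog A) n.+1.
  by rewrite scalerA mulVf ?scale1r ?natr_neq0.
split=> [Au|nu].
  have lu n : l n.+1 = u n.+1.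
    by rewrite /l Au /= scalerA divff ?scale1r ?natr_neq0.
  by move=> n; rewrite nl; apply: eq_bigr => k _; rewrite lu.
apply: tpsP => -[|n]; first by rewrite /= big_geq.
by rewrite -E (newton_rec_uniql A0 nl nu).
Qed.

End Logarithm.

(** * Coefficients of series in the x_i *)

(** The monomial [x_i ^ n]. Since [divcm] subtracts exponents with truncation, [divcm m (pcm i n)]
    is a true quotient only when [n <= m i]. *)
Definition pcm (i n : nat) : {cmonom nat} := [cmonom n | _ in fset1 i]%M.

Lemma pcmE i n j : pcm i n j = if i == j then n else 0%N.
Proof. by rewrite [LHS]cmE fsfunE in_fset1 eq_sym. Qed.

Lemma mdeg_pcm i n : mdeg (pcm i n) = n.
Proof.
rewrite (@mdegEw _ _ [fset i]%fset); last first.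
  apply/fsubsetP => j; rewrite -cmE_neq0 pcmE in_fset1 [j == i]eq_sym.
  by case: (i == j).
by rewrite big_seq_fset1 pcmE eqxx.
Qed.

Lemma divcm_pcmE (m : {cmonom nat}) i n j :
  divcm m (pcm i n) j = (if i == j then m j - n else m j)%N.
Proof. by rewrite divcmE pcmE; case: eqP => // _; rewrite subn0. Qed.

Lemma mul_divcm_pcm (m : {cmonom nat}) i n : (n <= m i)%N ->
  mmul (pcm i n) (divcm m (pcm i n)) = m :> {cmonom nat}.
Proof.
move=> nm; apply/eqP/cmP => j; rewrite cmM divcm_pcmE pcmE.
by case: eqP => [<-|//]; rewrite subnKC.
Qed.

Lemma divcm_mul (d e : {cmonom nat}) : divcm (mmul d e) d = e.
Proof. by apply/eqP/cmP => j; rewrite divcmE cmM addKn. Qed.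

Lemma mdeg_divcm_pcm (m : {cmonom nat}) i n : (n <= m i)%N ->
  mdeg (divcm m (pcm i n)) = (mdeg m - n)%N.
Proof.
by move=> nm; rewrite -{2}(mul_divcm_pcm nm) mdegM mdeg_pcm addKn.
Qed.

Section Coefficients.
Variable K : fieldType.
Implicit Types (f g : xps K) (m d e : {cmonom nat}).

Lemma xcoefD f g m : xcoef (f + g) m = xcoef f m + xcoef g m.
Proof. by []. Qed.

Lemma xcoefZ (c : K) f m : xcoef (c *: f) m = c * xcoef f m.
Proof. by []. Qed.

Lemma xcoef1 m : xcoef (1 : xps K) m = (m == mone)%:R.
Proof. by []. Qed.

Lemma xcoef_sum (I : Type) (r : seq I) (P : pred I) (F : I -> xps K) m :
  xcoef (\sum_(i <- r | P i) F i) m = \sum_(i <- r | P i) xcoef (F i) m.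
Proof. exact: (big_morph (fun f => xcoef f m)). Qed.

(** Only factorizations of [m] enter its coefficient, so an infinite series can be replaced by a
    finite truncation that agrees with it on the divisors of [m]. *)
Lemma eq_xcoefM f f' g g' m :
  (forall d e, mmul d e = m -> xcoef f d * xcoef g e = xcoef f' d * xcoef g' e) ->
  xcoef (f * g) m = xcoef (f' * g') m.
Proof. by move=> E; apply: eq_fsbigr => -[d e]; rewrite inE => /E. Qed.

Lemma xcoefM_neq0 f g m : xcoef (f * g) m != 0 ->
  exists d e, [/\ mmul d e = m, xcoef f d != 0 & xcoef g e != 0].
Proof.
apply: contra_neqP => ndiv; apply: fsbig1 => -[d e] /= dem.
apply/eqP; apply: contra_notT ndiv; rewrite mulf_eq0 negb_or => /andP[fd ge].
by exists d, e.
Qed.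

Definition mono d : xps K := XPS (fun m => (m == d)%:R).

Lemma xcoef_monoM_dvd d e g : xcoef (mono d * g) (mmul d e) = xcoef g e.
Proof.
rewrite [LHS](fsbigE [:: (d, e)]) //=.
- by rewrite big_cons big_nil mem_set //= eqxx mul1r addr0.
- by move=> p /=; rewrite inE => /eqP ->.
move=> [d' e'] /= de; rewrite inE xpair_eqE.
case: eqP => [dd|]; last by rewrite mul0r.
move: de; rewrite dd => /(congr1 (fun m => divcm m d)); rewrite !divcm_mul.
by move=> ->; rewrite eqxx.
Qed.

Lemma monoM d e : mono d * mono e = mono (mmul d e).
Proof.
apply: xpsP => m; have [->|mde] := eqVneq m (mmul d e).
  by rewrite xcoef_monoM_dvd /= !eqxx.
rewrite [RHS]/= (negPf mde); apply/eqP; apply: contraTT mde => /xcoefM_neq0.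
move=> [d' [e' [<- /=]]].
by case: (d' =P d) => [->|_]; case: (e' =P e) => [->|_]; rewrite !eqxx.
Qed.

Lemma xvarX i n : xvar K i ^+ n = mono (pcm i n).
Proof.
have pcm0 : pcm i 0 = mone :> {cmonom nat}.
  by apply/eqP/cmP => j; rewrite pcmE cm1 if_same.
elim: n => [|n IH]; first by rewrite expr0 pcm0.
rewrite exprS IH -[xvar K i]/(mono (pcm i 1)) monoM; congr mono.
by apply/eqP/cmP => j; rewrite cmM !pcmE; case: eqP.
Qed.

Lemma xcoef_xvarXM i n g m : xcoef (xvar K i ^+ n * g) m =
  if (n <= m i)%N then xcoef g (divcm m (pcm i n)) else 0.
Proof.
rewrite xvarX; case: leqP => [nm|mn].
  by rewrite -{1}(mul_divcm_pcm nm) xcoef_monoM_dvd.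
apply/eqP; apply: contraTT mn => /xcoefM_neq0 [d [e [<- /=]]].
case: (d =P _) => [-> _ _|]; last by rewrite eqxx.
by rewrite -leqNgt cmM pcmE eqxx leq_addr.
Qed.

(** For [n > 0] the monomial [x_i ^ n] really contains [x_i], so variables outside the support of
    [m] contribute nothing. *)
Lemma xcoef_psym n m (S : {fset nat}) : (0 < n)%N -> (finsupp m `<=` S)%fset ->
  xcoef (psym K n) m = xcoef (\sum_(i <- S) xvar K i ^+ n) m.
Proof.
move=> n0 mS; rewrite xcoef_sum /=; apply: fsbigTE => i iS; rewrite xvarX /=.
case: eqP => // mi; case/negP: iS; apply: (fsubsetP mS).
by rewrite -cmE_neq0 mi pcmE eqxx -lt0n.
Qed.

Lemma xcoef_psymM n g m : (0 < n)%N -> xcoef (psym K n * g) m =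
  \sum_(i <- finsupp m | (n <= m i)%N) xcoef g (divcm m (pcm i n)).
Proof.
move=> n0; rewrite (@eq_xcoefM _ (\sum_(i <- finsupp m) xvar K i ^+ n) _ g).
  rewrite mulr_suml xcoef_sum [RHS]big_mkcond; apply: eq_bigr => i _.
  exact: xcoef_xvarXM.
move=> d e dem; rewrite (@xcoef_psym _ _ (finsupp m)) //.
by apply/fsubsetP => i; rewrite -!cmE_neq0 -dem cmM addn_eq0 negb_and => ->.
Qed.

End Coefficients.

(** * Partitions *)

Fact mkpart_subproof (s : seq nat) :
  sorted geq (sort geq [seq i <- s | i != 0%N]) &&
  (0%N \notin sort geq [seq i <- s | i != 0%N]).
Proof.
rewrite sort_sorted => [|x y]; last exact: leq_total.
by rewrite mem_sort mem_filter eqxx.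
Qed.

(** Zeros are discarded so that every list yields a partition without side conditions. *)
Definition mkpart (s : seq nat) : intpart := IntPart (mkpart_subproof s).

Lemma part0 (lam : intpart) : 0%N \notin parts lam.
Proof. by case: lam => s /= /andP[]. Qed.

Lemma part_pos (lam : intpart) i : i \in parts lam -> (0 < i)%N.
Proof. by case: i => // /(negP (part0 lam)). Qed.

(** A sorted list is determined by its multiset of entries; identities between partitions can thus
    be proved up to permutation. *)
Lemma part_perm_inj (lam mu : intpart) : perm_eq lam mu -> lam = mu.
Proof.
move=> pe; apply: val_inj; apply: (sorted_eq (leT := geq) _ _ _ _ pe).
- by move=> y x z /= xy yz; apply: leq_trans yz xy.
- by move=> x y /andP[yx xy]; apply/eqP; rewrite eqn_leq; apply/andP.
- by case: lam {pe} => s /= /andP[].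
- by case: mu {pe} => s /= /andP[].
Qed.

Lemma mkpart_perm (s : seq nat) : 0%N \notin s -> perm_eq (mkpart s) s.
Proof.
move=> s0; rewrite /= perm_sort (all_filterP _) //.
by apply/allP => i; case: eqP => // -> /(negP s0).
Qed.

Lemma mkpartK (lam : intpart) : mkpart lam = lam.
Proof.
exact/part_perm_inj/mkpart_perm/part0.
Qed.

Lemma size_part (lam : intpart) : (size lam <= sumn lam)%N.
Proof.
have: forall i, i \in parts lam -> (0 < i)%N by exact: part_pos.
elim: (parts lam) => //= i s IH si; rewrite -add1n leq_add ?IH ?si ?mem_head //.
by move=> j js; rewrite si // inE js orbT.
Qed.

Lemma leq_sumn (s : seq nat) i : i \in s -> (i <= sumn s)%N.
Proof.
elim: s => //= j s IH; rewrite inE => /predU1P[->|/IH]; first exact: leq_addr.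
by move/leq_trans; apply; exact: leq_addl.
Qed.

(** A partition of size at most [n] has at most [n] parts, each at most [n], so it is the image of a
    bounded sequence over ['I_n.+1]. *)
Lemma finite_part_le n :
  finite_set [set lam : intpart | (sumn lam <= n)%N]%classic.
Proof.
pose h (b : {bseq n of 'I_n.+1}) := mkpart [seq val i | i <- b].
apply: (@sub_finite_set _ _ (h @` setT)%classic); last first.
  by apply: finite_image; exact: finite_finset.
move=> lam /= ln.
have sz : (size [seq inord i : 'I_n.+1 | i <- lam] <= n)%N.
  by rewrite size_map; apply: leq_trans ln; exact: size_part.
exists (Bseq sz) => //; rewrite -[RHS]mkpartK; congr mkpart => /=.
rewrite -map_comp -[RHS]map_id; apply/eq_in_map => i il /=.
by rewrite inordK // ltnS; apply: leq_trans ln; exact: leq_sumn.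
Qed.

Lemma finite_part n : finite_set [set lam : intpart | sumn lam = n]%classic.
Proof.
by apply: sub_finite_set (finite_part_le n) => lam /= ->.
Qed.

Definition parts_le n : {fset intpart} :=
  fset_set [set lam : intpart | (sumn lam <= n)%N]%classic.

Lemma mem_parts_le n (lam : intpart) : (lam \in parts_le n) = (sumn lam <= n)%N.
Proof.
by rewrite in_fset_set; [apply/idP/idP; rewrite inE | exact: finite_part_le].
Qed.

Definition parts_of n : {fset intpart} :=
  fset_set [set lam : intpart | sumn lam = n]%classic.

Lemma mem_parts_of n (lam : intpart) : (lam \in parts_of n) = (sumn lam == n).
Proof.
by rewrite in_fset_set; [apply/idP/eqP; rewrite inE | exact: finite_part].
Qed.

(** The order of this list carries no meaning; [mkpart (exps m)] is the type of the monomial [m]. *)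
Definition exps (m : {cmonom nat}) : seq nat := [seq m i | i <- finsupp m].

Lemma exps0 m : 0%N \notin exps m.
Proof.
apply/mapP => -[i]; rewrite -cmE_neq0 => /eqP mi /esym; exact: mi.
Qed.

Lemma sumn_exps m : sumn (exps m) = mdeg m.
Proof. by rewrite sumnE big_map mdegE. Qed.

Lemma perm_mkpart_exps m : perm_eq (mkpart (exps m)) (exps m).
Proof. exact/mkpart_perm/exps0. Qed.

Lemma perm_expsP m (lam : intpart) :
  reflect (lam = mkpart (exps m)) (perm_eq (exps m) lam).
Proof.
apply: (iffP idP) => [pe|->]; last by rewrite perm_sym perm_mkpart_exps.
by apply: part_perm_inj; rewrite perm_sym (perm_trans (perm_mkpart_exps m)).
Qed.

Lemma sumn_mkpart_exps m : sumn (mkpart (exps m)) = mdeg m.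
Proof. by rewrite (perm_sumn (perm_mkpart_exps m)) sumn_exps. Qed.

(** * Products of the F(x_i t) *)

Section MultiplicativeSeries.
Variable K : fieldType.
Implicit Types (a b : nat -> K) (m : {cmonom nat}).

(** When [a 0 = 1], the part of degree [n] of the product over [i] of the series
    [\sum_k a k * x_i ^ k]. Conditions (a) and (c) are both rewritten to this form. *)
Definition mult_series a n : xps K :=
  XPS (fun m => if mdeg m == n then \prod_(i <- exps m) a i else 0).

(** Since [a 0 = 1], variables that do not occur in [m] contribute trivial factors. *)
Lemma prod_exps a m (r : seq nat) : a 0%N = 1 -> uniq r ->
  {subset finsupp m <= r} -> \prod_(i <- exps m) a i = \prod_(i <- r) a (m i).
Proof.
move=> a0 ur mr; rewrite big_map [RHS](bigID (fun i => i \in finsupp m)) /=.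
rewrite [X in _ = _ * X]big1 ?mulr1 => [|i]; last first.
  by rewrite -cmE_eq0 => /eqP ->.
rewrite -[RHS]big_filter; apply: perm_big.
apply: uniq_perm; rewrite ?filter_uniq ?fset_uniq // => i.
by rewrite mem_filter; case: (boolP (i \in finsupp m)) => // /mr ->.
Qed.

Lemma mult_series0 a : mult_series a 0 = 1.
Proof.
apply: xpsP => m; rewrite xcoef1 /= mdeg_eq0; case: eqP => // ->.
by rewrite /exps mdom1 big_nil.
Qed.

(** Reading the powers of the single variable [x_0] recovers [a]; this makes the seed unique. *)
Lemma xcoef_mult_pcm a n : a 0%N = 1 -> xcoef (mult_series a n) (pcm 0 n) = a n.
Proof.
move=> a0; rewrite /= mdeg_pcm eqxx (@prod_exps _ _ [:: 0%N]) //.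
  by rewrite big_seq1 pcmE.
by move=> i; rewrite -cmE_neq0 pcmE inE; case: (0%N =P i) => [<-|//].
Qed.

Lemma xcoef_substM (F : tps K^o) i j (g : xps K) m :
  xcoef (tcoef (subst_xt F i) j * g) m = (tcoef F j : K) *
    (if (j <= m i)%N then xcoef g (divcm m (pcm i j)) else 0).
Proof. by rewrite -xcoef_xvarXM -xcoefZ scalerAl. Qed.

(** Induction on [N]: the factor [F(x_N t)] must supply the whole power of [x_N] in [m], because the
    other factors contain only earlier variables. *)
Lemma xcoef_prod_subst (F : tps K^o) N n m :
  xcoef (tcoef (\prod_(i < N) subst_xt F i) n) m =
  if (mdeg m == n) && all (ltn^~ N) (finsupp m)
  then \prod_(i < N) (tcoef F (m i) : K) else 0.
Proof.
elim: N n m => [|N IH] n m.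
  rewrite !big_ord0; case: n => [|n]; last first.
    rewrite [LHS]/= ifF //; apply/negP => /andP[/eqP dm /allP m0].
    suff /eqP: m = mone by rewrite -mdeg_eq0 dm.
    apply/eqP/cmP => i; rewrite cm1; apply/eqP; rewrite cmE_eq0.
    by apply/negP => /m0.
  rewrite [tcoef _ _]/= xcoef1 mdeg_eq0; case: eqP => [->|//].
  by rewrite mdom1.
rewrite big_ord_recr [X in tcoef X _]/= mulrC tcoefM xcoef_sum.
rewrite (eq_bigr (fun j : 'I_n.+1 => (tcoef F j : K) * (if (j <= m N)%N then
  if (mdeg (divcm m (pcm N j)) == (n - j)%N) &&
     all (ltn^~ N) (finsupp (divcm m (pcm N j)))
  then \prod_(i < N) (tcoef F (divcm m (pcm N j) i) : K) else 0 else 0)));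
  last first.
  by move=> j _; rewrite -IH; exact: xcoef_substM.
have nz j : (j <= m N)%N -> all (ltn^~ N) (finsupp (divcm m (pcm N j))) -> j = m N.
  move=> jm /allP mj; apply/eqP; rewrite eqn_leq jm -subn_eq0.
  have -> : (m N - j)%N = divcm m (pcm N j) N by rewrite divcm_pcmE eqxx.
  by rewrite cmE_eq0; apply/negP => /mj /=; rewrite ltnn.
have [mn|nm] := leqP (m N) n; last first.
  rewrite big1 => [|j _].
    rewrite ifF //; apply/negP => /andP[/eqP dm _].
    by move: nm; rewrite -dm ltnNge leq_mdeg.
  case: leqP => [jm|_]; last by rewrite mulr0.
  case: andP => [[_ /(nz _ jm) E]|_]; last by rewrite mulr0.
  by move: (ltn_ord j); rewrite E ltnS leqNgt nm.
(* The only surviving index is [j = m N], which is in range because [m N <= n]. *)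
rewrite (bigD1 (inord (m N))) //= inordK ?ltnS // leqnn.
rewrite [X in _ + X = _]big1 ?addr0 => [|j jN].
  rewrite mdeg_divcm_pcm // big_ord_recr /=.
  have -> : (mdeg m - m N == n - m N)%N = (mdeg m == n).
    rewrite -(eqn_add2r (m N)) !subnK //; exact: leq_mdeg.
  have -> : all (ltn^~ N) (finsupp (divcm m (pcm N (m N)))) =
            all (ltn^~ N.+1) (finsupp m).
    apply/allP/allP => H i.
      move=> im; rewrite /= ltnS leq_eqVlt; case: eqP => //= iN.
      apply: H; rewrite -cmE_neq0 divcm_pcmE; case: (N =P i) => [/esym//|_].
      by rewrite cmE_neq0.
    rewrite -cmE_neq0 divcm_pcmE; case: (N =P i) => [<-|/eqP iN]; first by rewrite subnn.
    rewrite cmE_neq0 => /H /=; rewrite ltnS leq_eqVlt eq_sym (negPf iN).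
    by [].
  case: ifP => _; last by rewrite mulr0.
  rewrite mulrC; congr (_ * _); apply: eq_bigr => i _.
  by rewrite divcm_pcmE gtn_eqF.
case: leqP => [jm|_]; last by rewrite mulr0.
case: andP => [[_ /(nz _ jm) E]|_]; last by rewrite mulr0.
by case/eqP: jN; apply: val_inj; rewrite /= inordK -?E.
Qed.

Lemma exists_supp_bound m : exists N0, forall N, (N0 <= N)%N ->
  all (ltn^~ N) (finsupp m).
Proof.
exists (\max_(i <- finsupp m) i.+1)%N => N mN; apply/allP => i im /=.
by apply: leq_trans mN; rewrite (big_fsetD1 i) //= leq_max leqnn.
Qed.

(** The coefficient of [m] in the partial products is constant as soon as [N] exceeds every index in
    the support of [m]. *)
Lemma is_seedP (F : tps K^o) (R : nat -> xps K) : is_seed F (TPS R) <->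
  tcoef F 0 = 1 /\ forall n, R n = mult_series (tcoef F) n.
Proof.
have E m N : tcoef F 0 = 1 -> all (ltn^~ N) (finsupp m) ->
    \prod_(i < N) (tcoef F (m i) : K) = \prod_(i <- exps m) tcoef F i.
  move=> F0 /allP mN; rewrite (@prod_exps _ _ (iota 0 N)) ?iota_uniq //.
    by rewrite -(big_mkord xpredT (fun i => tcoef F (m i) : K)) /index_iota subn0.
  by move=> i /mN; rewrite mem_iota.
split=> -[F0 H]; split=> //.
  move=> n; apply: xpsP => m; have [N1 h1] := H n m.
  have [N2 h2] := exists_supp_bound m; have := h1 (maxn N1 N2).
  rewrite leq_maxl => /(_ isT) /= <-; rewrite xcoef_prod_subst.
  by rewrite (h2 _ (leq_maxr _ _)) andbT E // h2 // leq_maxr.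
move=> n m; have [N2 h2] := exists_supp_bound m; exists N2 => N /h2 mN.
by rewrite xcoef_prod_subst mN andbT E //= H.
Qed.

Lemma monomial_expansionP (R : nat -> xps K) a : R 0%N = 1 ->
  monomial_expansion R a <-> a 0%N = 1 /\ forall n, R n = mult_series a n.
Proof.
move=> R0.
have E n : \sum_(lam \in [set lam : intpart | sumn lam = n]%classic)
    (\prod_(i <- lam) a i) *: msym_part K lam = mult_series a n.
  rewrite fsbig_finite; last exact: finite_part.
  apply: xpsP => m; rewrite xcoef_sum [RHS]/=.
  transitivity (\sum_(lam <- parts_of n)
      (\prod_(i <- lam) a i) * (perm_eq (exps m) lam)%:R); first exact: eq_bigr.
  case: eqP => [dm|dm].
    rewrite (bigD1_seq (mkpart (exps m))) ?fset_uniq //=; last first.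
      by rewrite mem_parts_of sumn_mkpart_exps dm.
    have /perm_expsP -> := erefl (mkpart (exps m)).
    rewrite mulr1 (perm_big _ (perm_mkpart_exps m)).
    rewrite [X in _ + X = _]big1 ?addr0 // => lam.
    by case: perm_expsP => [->|]; rewrite ?eqxx // mulr0.
  rewrite big_seq big1 // => lam; rewrite mem_parts_of => /eqP ln.
  case: perm_expsP => [lm|]; last by rewrite mulr0.
  by case: dm; rewrite -sumn_mkpart_exps -lm.
split=> -[a0 H]; split=> //.
  by case=> [|n]; rewrite ?R0 ?mult_series0 // H // E.
by move=> n _; rewrite H E.
Qed.

(** At a monomial [m] of degree [n], write [n] as the sum of the exponents [m i] and apply the
    scalar recursion to [m i * a (m i)] for each [i]. The resulting product of [a (m i - k)] with
    the factors of the other variables is the coefficient at [m / x_i^k]. *)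
Lemma newton_rec_mult a b : a 0%N = 1 -> newton_rec (b : nat -> K^o) a ->
  newton_rec (fun n => b n *: psym K n) (mult_series a).
Proof.
move=> a0 nab n; apply: xpsP => m; rewrite xcoefZ xcoef_sum.
transitivity (\sum_(k < n) b k.+1 * \sum_(i <- finsupp m | (k < m i)%N)
    xcoef (mult_series a (n - k.+1)%N) (divcm m (pcm i k.+1))); last first.
  by apply: eq_bigr => k _; rewrite -xcoef_psymM // -xcoefZ scalerAl.
rewrite [xcoef (mult_series _ _) _]/=; case: (eqVneq (mdeg m) n) => dm; last first.
  rewrite mulr0 big1 // => k _; rewrite big1 ?mulr0 // => i km /=.
  rewrite mdeg_divcm_pcm // ifF //; apply: contraNF dm => /eqP E.
  by rewrite -(subnK (leq_trans km (leq_mdeg m i))) E subnK.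
transitivity (\sum_(i <- finsupp m) \sum_(k < n | (k.+1 <= m i)%N)
   (b k.+1 * a (m i - k.+1)%N) * \prod_(j <- finsupp m | j != i) a (m j)).
  rewrite -{1}dm mdegE natr_sum mulr_suml [LHS]big_seq [RHS]big_seq.
  apply: eq_bigr => i im.
  rewrite big_map (bigD1_seq i) ?fset_uniq //= mulrA -mulr_suml; congr (_ * _).
  have := nab (m i); rewrite -[X in X = _]/((m i)%:R * a (m i)) => ->.
  have mn : (m i <= n)%N by rewrite -dm leq_mdeg.
  by rewrite (big_ord_widen _ (fun k => b k.+1 * a (m i - k.+1)%N) mn).
rewrite (exchange_big_dep xpredT) //=; apply: eq_bigr => k _.
rewrite mulr_sumr big_seq_cond [RHS]big_seq_cond; apply: eq_bigr => i /andP[im km].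
rewrite mdeg_divcm_pcm // dm eqxx -mulrA; congr (_ * _).
(* The product is taken over the support of [m], because [x_i] disappears from the quotient when
   [k.+1 = m i]; its factor is then [a 0 = 1]. *)
rewrite (@prod_exps _ _ (finsupp m)) ?fset_uniq //; last first.
  by move=> j; rewrite -!cmE_neq0 divcm_pcmE; case: (i =P j) => // <-; case: (m i).
rewrite [RHS](bigD1_seq i) ?fset_uniq //= divcm_pcmE eqxx; congr (_ * _).
by apply: eq_bigr => j ji; rewrite divcm_pcmE eq_sym (negPf ji).
Qed.

Lemma xcoef_psymM_pcm k n (g : xps K) : (0 < k)%N -> (k <= n)%N ->
  xcoef (psym K k * g) (pcm 0 n) = xcoef g (pcm 0 (n - k)).
Proof.
move=> k0 kn; rewrite xcoef_psymM //.
have -> : finsupp (pcm 0 n) = [fset 0%N]%fset.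
  apply/fsetP => i; rewrite -cmE_neq0 pcmE in_fset1 [i == _]eq_sym.
  by case: (0%N =P i) => // _; rewrite -lt0n (leq_trans k0).
rewrite big_mkcond big_seq_fset1 pcmE eqxx kn; congr xcoef.
by apply/eqP/cmP => i; rewrite divcm_pcmE !pcmE; case: eqP.
Qed.

(** Keeping only the variable [x_0] turns [p_k] into [x_0 ^ k], and the recursion becomes one
    between scalars. *)
Lemma newton_rec_psym_pcm b (R : nat -> xps K) :
  newton_rec (fun n => b n *: psym K n) R ->
  newton_rec (b : nat -> K^o) (fun n => xcoef (R n) (pcm 0 n)).
Proof.
move=> nR n; have := congr1 (fun f => xcoef f (pcm 0 n)) (nR n).
rewrite xcoefZ xcoef_sum => E; rewrite -[LHS]/(n%:R * xcoef (R n) (pcm 0 n)) E.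
by apply: eq_bigr => k _; rewrite -xcoef_psymM_pcm // -scalerAl.
Qed.

End MultiplicativeSeries.

(** * The power sum basis *)

Lemma perm_exps_div (m : {cmonom nat}) i : i \in finsupp m ->
  perm_eq (exps m) (m i :: exps (divcm m (pcm i (m i)))).
Proof.
move=> im; set m' := divcm m (pcm i (m i)).
have m'E j : m' j = if i == j then 0%N else m j.
  by rewrite /m' divcm_pcmE; case: (i =P j) => // ->; rewrite subnn.
have pe : perm_eq (finsupp m) (i :: finsupp m').
  apply: uniq_perm; rewrite /= ?fset_uniq // -?cmE_eq0 ?m'E ?eqxx // => j.
  rewrite inE -!cmE_neq0 m'E [j == i]eq_sym.
  by case: (i =P j) => // <-; rewrite cmE_neq0 im.
rewrite (perm_trans (perm_map _ pe)) //= perm_cons.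
suff -> : [seq m j | j <- finsupp m'] = exps m' by [].
apply/eq_in_map => j; rewrite -cmE_neq0 !m'E.
by case: (i =P j).
Qed.

Lemma size_exps_div (m : {cmonom nat}) i k : (k < m i)%N ->
  size (exps (divcm m (pcm i k))) = size (exps m).
Proof.
move=> km; rewrite !size_map; congr size; congr enum_fset.
apply/fsetP => j; rewrite -!cmE_neq0 divcm_pcmE.
by case: (i =P j) => // <-; rewrite -!lt0n subn_gt0 km (leq_ltn_trans _ km).
Qed.

(* The number of ways to write m as a product of powers x_(h 0)^(s_0) *
   x_(h 1)^(s_1) * ..., that is, the coefficient of m in p_(s_0) p_(s_1) ... *)
Fixpoint psum_count (s : seq nat) (m : {cmonom nat}) : nat :=
  if s is k :: s' then
    (\sum_(i <- finsupp m | (k <= m i)%N) psum_count s' (divcm m (pcm i k)))%N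
  else (m == mone :> {cmonom nat}).

(** Each part of [s] is placed on a variable. At most as many variables as parts are used, and if
    the numbers agree then no two parts share a variable, so the exponents are the parts
    themselves. *)
Lemma psum_count_gt0 s m : 0%N \notin s -> (0 < psum_count s m)%N ->
  [/\ mdeg m = sumn s, (size (exps m) <= size s)%N
    & size (exps m) = size s -> perm_eq (exps m) s].
Proof.
elim: s m => [|k s IH] m /=.
  by move=> _; case: (m =P mone) => // -> _; rewrite mdeg1 /exps mdom1.
rewrite inE negb_or eq_sym -lt0n => /andP[k0 s0]; rewrite lt0n sum_nat_seq_neq0.
case/hasP => i im /andP[km]; rewrite -lt0n => /(IH _ s0) [d sz pe].
have dm : mdeg m = (k + sumn s)%N.
  by rewrite -d mdeg_divcm_pcm // subnKC // (leq_trans km) ?leq_mdeg.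
(* Either the part [k] exhausts the exponent of [x_i] and one variable disappears, or [x_i] remains
   and the bound on the number of variables is strict. *)
move: km; rewrite leq_eqVlt => /predU1P[mi|km].
  rewrite mi in sz pe; have pm := perm_exps_div im.
  rewrite (perm_size pm) /= ltnS; split=> // -[/pe {}pe].
  by rewrite (perm_trans pm) // mi perm_cons.
rewrite size_exps_div // in sz pe; split=> //; first exact: leqW.
by move=> E; move: sz; rewrite E ltnn.
Qed.

(** Placing each part on a variable with exactly that exponent is one of the ways counted. In
    characteristic 0 this gives nonzero diagonal entries. *)
Lemma psum_count_perm s m : perm_eq (exps m) s -> (0 < psum_count s m)%N.
Proof.
elim: s m => [|k s IH] m pe /=.
  rewrite lt0b -mdeg_eq0 -sumn_exps (perm_sumn pe).
  by [].
have /mapP[i im mi] : k \in exps m by rewrite (perm_mem pe) mem_head.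
rewrite lt0n sum_nat_seq_neq0; apply/hasP; exists i => //.
rewrite -mi leqnn -lt0n /= IH // -(perm_cons k) -(permPr pe) perm_sym {1}mi mi.
exact: perm_exps_div.
Qed.

Lemma perm_finsupp_bij (h : nat -> nat) (m m' : {cmonom nat}) : bijective h ->
  (forall i, m' i = m (h i)) ->
  perm_eq (finsupp m) [seq h i | i <- finsupp m'].
Proof.
move=> bh mm'; have [g hK gK] := bh.
apply: uniq_perm; rewrite ?(map_inj_uniq (bij_inj bh)) ?fset_uniq // => i.
by rewrite -(gK i) (mem_map (bij_inj bh)) -!cmE_neq0 mm'.
Qed.

Lemma psum_count_sym s (h : nat -> nat) (m m' : {cmonom nat}) : bijective h ->
  (forall i, m' i = m (h i)) -> psum_count s m' = psum_count s m.
Proof.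
move=> bh; have [g hK gK] := bh; elim: s m m' => [|k s IH] m m' mm' /=.
  congr nat_of_bool; apply/eqP/eqP => E.
    by apply/eqP/cmP => i; rewrite -(gK i) -mm' E !cm1.
  by apply/eqP/cmP => i; rewrite mm' E !cm1.
rewrite (perm_big _ (perm_finsupp_bij bh mm')) big_map /=.
under [in RHS]eq_bigl do rewrite -mm'.
apply: eq_bigr => i _; apply: IH => j; rewrite !divcm_pcmE mm'.
by rewrite (bij_eq bh).
Qed.

Lemma exists_exps (lam : intpart) : exists m : {cmonom nat}, perm_eq (exps m) lam.
Proof.
pose m : {cmonom nat} :=
  [cmonom nth 0%N lam i | i in seq_fset tt (iota 0 (size lam))]%M.
have mE i : m i = nth 0%N lam i.
  rewrite [LHS]cmE fsfunE seq_fsetE mem_iota /= add0n; case: ltnP => // sz.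
  by rewrite nth_default.
exists m; have pe : perm_eq (finsupp m) (iota 0 (size lam)).
  apply: uniq_perm; rewrite ?fset_uniq ?iota_uniq // => i.
  rewrite -cmE_neq0 mE mem_iota /= add0n; case: ltnP => sz.
    by rewrite -lt0n; apply: (@part_pos lam); exact: mem_nth.
  by rewrite nth_default.
rewrite (perm_trans (perm_map _ pe)) // (eq_map mE) -/(mkseq _ _) mkseq_nth.
exact: perm_refl.
Qed.

Section SymmetricSeries.
Variable K : fieldType.
Implicit Types (f g : xps K) (c d : intpart -> K) (lam mu nu : intpart).

(** [symmetric_series] speaks of bijections of all indices, so the rearrangement of the exponents
    has to be extended to such a bijection. *)
Lemma symmetric_perm f m m' : symmetric_series f ->
  perm_eq (exps m) (exps m') -> xcoef f m = xcoef f m'.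
Proof.
move=> fs pe; have [N1 h1] := exists_supp_bound m.
have [N2 h2] := exists_supp_bound m'; pose N := maxn N1 N2.
(* Padded with zeros, [exps e] is up to order the list of the first [N] exponents. *)
have sub (e : {cmonom nat}) : all (ltn^~ N) (finsupp e) ->
    perm_eq [seq e i | i <- iota 0 N] (exps e ++ nseq (N - size (exps e)) 0%N).
  move=> /allP eN.
  have pi : perm_eq (iota 0 N)
      (finsupp e ++ [seq i <- iota 0 N | i \notin finsupp e]).
    rewrite -(perm_filterC (fun i => i \in finsupp e) (iota 0 N)) perm_cat2r.
    apply: uniq_perm; rewrite ?filter_uniq ?iota_uniq ?fset_uniq // => i.
    by rewrite mem_filter mem_iota /=; case: (boolP (i \in finsupp e)) => // /eN.
  have sz := perm_size pi; rewrite size_iota size_cat in sz.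
  rewrite (perm_trans (perm_map _ pi)) // map_cat perm_cat2l.
  have /all_pred1P E : all (pred1 0%N)
      [seq e i | i <- iota 0 N & i \notin finsupp e].
    by apply/allP => x /mapP[i]; rewrite mem_filter -cmE_eq0 => /andP[ei _] ->.
  rewrite E !size_map -[X in perm_eq (nseq X _)](addKn (size (finsupp e))) -sz.
  exact: perm_refl.
have pN : perm_eq [seq m' i | i <- iota 0 N] [seq m i | i <- iota 0 N].
  rewrite (permPl (sub _ (h2 _ (leq_maxr _ _)))).
  rewrite perm_sym (permPl (sub _ (h1 _ (leq_maxl _ _)))).
  by rewrite (perm_size pe) perm_cat2r.
have [Is pI E] := perm_iotaP 0%N pN; rewrite size_map size_iota in pI.
have uI : uniq Is by rewrite (perm_uniq pI) iota_uniq.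
have sI : size Is = N by rewrite (perm_size pI) size_iota.
have memI i : (i \in Is) = (i < N)%N by rewrite (perm_mem pI) mem_iota.
(* [Is] permutes the indices below [N] and matches [m'] with [m]; the identity extends it beyond
   [N]. *)
pose s i := if (i < N)%N then nth 0%N Is i else i.
have sN i : (i < N)%N -> (s i < N)%N.
  by move=> iN; rewrite /s iN -memI mem_nth ?sI.
have bs : bijective s.
  exists (fun i => if (i < N)%N then index i Is else i) => i.
    have [iN|iN] := ltnP i N; first by rewrite sN // /s iN index_uniq // sI.
    have si : s i = i by rewrite /s ltnNge iN.
    by rewrite si ltnNge iN.
  have [iN|iN] := ltnP i N; last by rewrite /s ltnNge iN.
  by rewrite /s -[X in (_ < X)%N]sI index_mem memI iN nth_index ?memI.
apply/esym; apply: (fs s bs) => i.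
have [iN|iN] := ltnP i N; last first.
  have out (e : {cmonom nat}) : all (ltn^~ N) (finsupp e) -> e i = 0%N.
    move=> /allP eN; apply/eqP; rewrite cmE_eq0; apply/negP => /eN /=.
    by rewrite ltnNge iN.
  by rewrite /s ltnNge iN /= !out ?h1 ?h2 ?leq_maxl ?leq_maxr.
have := congr1 (fun t => nth 0%N t i) E.
rewrite (nth_map 0%N) ?size_iota // nth_iota // add0n => ->.
have si : s i = nth 0%N Is i by rewrite /s iN.
by rewrite (nth_map 0%N) ?sI // -si (nth_map 0%N) ?size_iota ?nth_iota ?sN.
Qed.

Lemma xcoef_psym_prod (s : seq nat) m : 0%N \notin s ->
  xcoef (\prod_(i <- s) psym K i) m = (psum_count s m)%:R.
Proof.
elim: s m => [|k s IH] m /=; first by rewrite big_nil xcoef1.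
rewrite inE negb_or eq_sym -lt0n => /andP[k0 s0].
rewrite big_cons xcoef_psymM // natr_sum; apply: eq_bigr => i _; exact: IH.
Qed.

Lemma xcoef_psym_part lam m :
  xcoef (psym_part K lam) m = (psum_count lam m)%:R.
Proof. exact/xcoef_psym_prod/part0. Qed.

Lemma psym_part_supp lam m : xcoef (psym_part K lam) m != 0 ->
  [/\ mdeg m = sumn lam, (size (exps m) <= size lam)%N
    & size (exps m) = size lam -> lam = mkpart (exps m)].
Proof.
rewrite xcoef_psym_part => nz.
have [|-> -> H] := psum_count_gt0 (part0 lam) (m := m).
  by rewrite lt0n; apply: contraNneq nz => ->.
by split=> // /H /perm_expsP.
Qed.

Lemma psym_part_sym lam : symmetric_series (psym_part K lam).
Proof.
by move=> h bh m m' mm'; rewrite !xcoef_psym_part (psum_count_sym _ bh mm').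
Qed.

(** By homogeneity only partitions of [mdeg m] contribute. A larger [S] is allowed so that several
    monomials can share one finite index set. *)
Lemma xcoef_psym_series c m (S : {fset intpart}) :
  (forall lam, sumn lam = mdeg m -> lam \in S) ->
  xcoef (psym_series c) m = \sum_(lam <- S) c lam * xcoef (psym_part K lam) m.
Proof.
move=> mS; apply: fsbigTE => lam lS; rewrite xcoefZ.
have [->|/psym_part_supp[d _ _]] := eqVneq (xcoef (psym_part K lam) m) 0.
  by rewrite mulr0.
by case/negP: lS; apply: mS.
Qed.

Lemma xcoef_psym_series_of c m : xcoef (psym_series c) m =
  \sum_(lam <- parts_of (mdeg m)) c lam * xcoef (psym_part K lam) m.
Proof.
by apply: xcoef_psym_series => lam ld; rewrite mem_parts_of ld.
Qed.

Lemma psym_seriesD c d :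
  psym_series (fun lam => c lam + d lam) = psym_series c + psym_series d.
Proof.
apply: xpsP => m; rewrite xcoefD !xcoef_psym_series_of -big_split.
by apply: eq_bigr => lam _; rewrite mulrDl.
Qed.

Lemma psym_seriesZ (a : K) c :
  psym_series (fun lam => a * c lam) = a *: psym_series c.
Proof.
apply: xpsP => m; rewrite xcoefZ !xcoef_psym_series_of mulr_sumr.
by apply: eq_bigr => lam _; rewrite mulrA.
Qed.

Lemma psym_series_sym c : symmetric_series (psym_series c).
Proof.
move=> h bh m m' mm'; rewrite !xcoef_psym_series_of.
have -> : mdeg m' = mdeg m.
  rewrite !mdegE (perm_big _ (perm_finsupp_bij bh mm')) big_map.
  by apply: eq_bigr => i _; rewrite mm'.
by apply: eq_bigr => lam _; rewrite (@psym_part_sym lam _ bh _ _ mm').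
Qed.

Hypothesis charK : [pchar K] =i pred0.

Lemma psym_part_exps_neq0 lam m : perm_eq (exps m) lam ->
  xcoef (psym_part K lam) m != 0.
Proof.
by move=> /psum_count_perm pm; rewrite xcoef_psym_part natr_neq0.
Qed.

Lemma psym_part_neq0 lam : psym_part K lam != 0.
Proof.
have [m /psym_part_exps_neq0] := exists_exps lam.
by apply: contraNneq => ->.
Qed.

(* The coefficient of the monomial x^lam in p_mu vanishes unless mu is longer
   than lam or equal to it. *)
Lemma psym_series_inj : injective (@psym_series K).
Proof.
move=> c d cd; apply: funext => lam.
(* Induction from the longest partitions of [n] downwards: [c] and [d] already agree on all
   partitions of [n] longer than [lam]. *)
suff: forall n k lam, sumn lam = n -> (n - size lam < k)%N -> c lam = d lam.
  by apply; [|exact: ltnSn].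
move=> n; elim=> // k IH {}lam ln lk.
have [m pm] := exists_exps lam.
have mn : mdeg m = n by rewrite -sumn_exps (perm_sumn pm).
have : xcoef (psym_series c) m = xcoef (psym_series d) m by rewrite cd.
rewrite !xcoef_psym_series_of mn.
have lP : lam \in parts_of n by rewrite mem_parts_of ln.
rewrite !(bigD1_seq lam) ?fset_uniq //= => E.
apply: (mulIf (psym_part_exps_neq0 pm)); move: E.
set C := \sum_(_ <- _ | _) _; set D := \sum_(_ <- _ | _) _.
suff -> : C = D by apply: addIr.
rewrite /C /D big_seq_cond [RHS]big_seq_cond.
apply: eq_bigr => mu; rewrite mem_parts_of => /andP[/eqP mun ml].
have [->|/psym_part_supp[_ sz eq]] := eqVneq (xcoef (psym_part K mu) m) 0.
  by rewrite !mulr0.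
rewrite (IH mu mun) //; rewrite -ltnS; apply: leq_trans lk; rewrite ltnS.
have lm : (size lam < size mu)%N.
  rewrite -(perm_size pm) ltn_neqAle sz andbT; apply: contraNneq ml => /eq ->.
  by apply/eqP/esym/perm_expsP.
by apply: ltn_sub2l => //; rewrite (leq_trans lm) // -mun size_part.
Qed.

Lemma psym_span n l f : symmetric_series f ->
  (forall m, mdeg m = n -> xcoef f m != 0 -> (size (exps m) < l)%N) ->
  exists c, forall m, mdeg m = n ->
    xcoef f m = \sum_(lam <- parts_of n) c lam * xcoef (psym_part K lam) m.
Proof.
elim: l f => [|l IH] f fs fl.
  exists (fun=> 0) => m mn; rewrite big1 => [|lam _]; last by rewrite mul0r.
  by apply/eqP; apply: contraTT isT => /(fl _ mn).
have [rep repP] := choice exists_exps.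
(* By symmetry, matching [f] at the representative [rep lam] matches it at every monomial of type
   [lam]. *)
pose c0 lam := if size lam == l
  then xcoef f (rep lam) / xcoef (psym_part K lam) (rep lam) else 0.
pose g := f - \sum_(lam <- parts_of n) c0 lam *: psym_part K lam.
have gE m : xcoef g m = xcoef f m -
    \sum_(lam <- parts_of n) c0 lam * xcoef (psym_part K lam) m.
  by rewrite -[LHS]/(xcoef f m - xcoef _ m) xcoef_sum.
have [||c gc] := IH g.
- move=> h bh m m' mm'; rewrite !gE (fs _ bh _ _ mm'); congr (_ - _).
  by apply: eq_bigr => lam _; rewrite (@psym_part_sym lam _ bh _ _ mm').
- move=> m mn; apply: contraNT; rewrite -leqNgt gE => lm; apply/eqP.
  have zero lam : lam != mkpart (exps m) ->
      c0 lam * xcoef (psym_part K lam) m = 0.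
    move=> ne; rewrite /c0; case: eqP => [sl|]; last by rewrite mul0r.
    have [->|/psym_part_supp[_ sz eq]] := eqVneq (xcoef (psym_part K lam) m) 0.
      by rewrite mulr0.
    case/eqP: ne; apply: eq; apply/eqP; rewrite eqn_leq sz /= sl.
    exact: lm.
  have sm := perm_size (perm_mkpart_exps m).
  have mP : mkpart (exps m) \in parts_of n.
    by rewrite mem_parts_of sumn_mkpart_exps mn.
  rewrite (bigD1_seq (mkpart (exps m))) ?fset_uniq //=.
  rewrite [X in _ - (_ + X)]big1 => [|lam]; last exact: zero.
  rewrite addr0 /c0 sm; case: eqP => [E|/eqP ne].
    have pm : perm_eq (exps m) (exps (rep (mkpart (exps m)))).
      by rewrite perm_sym (permPl (repP _)) perm_mkpart_exps.
    rewrite -(symmetric_perm fs pm) -(symmetric_perm (@psym_part_sym _) pm).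
    rewrite divfK ?subrr // psym_part_exps_neq0 // perm_sym.
    exact: perm_mkpart_exps.
  rewrite mul0r subr0; apply/eqP; apply: contraTT isT => /(fl _ mn).
  by rewrite ltnS leq_eqVlt (negPf ne) ltnNge lm.
exists (fun lam => c0 lam + c lam) => m mn.
under eq_bigr do rewrite mulrDl.
by rewrite big_split /= -(gc m mn) gE addrC subrK.
Qed.

Lemma psym_series_surj f : symmetric_series f -> exists c, f = psym_series c.
Proof.
move=> fs.
have /choice[c fc] n : exists c, forall m, mdeg m = n ->
    xcoef f m = \sum_(lam <- parts_of n) c lam * xcoef (psym_part K lam) m.
  apply: (@psym_span n n.+1) => // m <- _; rewrite ltnS -sumn_mkpart_exps.
  by rewrite -(perm_size (perm_mkpart_exps m)) size_part.
exists (fun lam => c (sumn lam) lam); apply: xpsP => m.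
rewrite xcoef_psym_series_of (fc _ m erefl) [LHS]big_seq [RHS]big_seq.
by apply: eq_bigr => lam; rewrite mem_parts_of => /eqP ->.
Qed.

(** Surjectivity of [psym_series] ensures that [xget] does not return its default value. *)
Lemma psym_coordK f : symmetric_series f -> psym_series (psym_coord f) = f.
Proof.
move=> /psym_series_surj[c fc]; rewrite /psym_coord.
by case: xgetP => [d _ /= <-|/(_ c)] //; case.
Qed.

Lemma psym_seriesK c : psym_coord (psym_series c) = c.
Proof. exact/psym_series_inj/psym_coordK/psym_series_sym. Qed.

End SymmetricSeries.

(** * Power sum expansions *)

Definition part_add (j : nat) (mu : intpart) : intpart := mkpart (j :: mu).

Lemma part_add_perm j mu : (0 < j)%N -> perm_eq (part_add j mu) (j :: mu).
Proof.
move=> j0; apply: mkpart_perm; rewrite inE negb_or part0 andbT.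
by rewrite eq_sym -lt0n.
Qed.

Lemma sumn_part_add j mu : (0 < j)%N -> sumn (part_add j mu) = (j + sumn mu)%N.
Proof. by move=> j0; rewrite (perm_sumn (part_add_perm mu j0)). Qed.

Lemma part_add_inj j : (0 < j)%N -> injective (part_add j).
Proof.
move=> j0 mu nu E; apply: part_perm_inj; rewrite -(perm_cons j).
by rewrite -(permPl (part_add_perm mu j0)) E part_add_perm.
Qed.

(** Removing one copy of [j] is the inverse bijection. *)
Lemma perm_parts_add n j : (0 < j <= n)%N ->
  perm_eq [seq lam <- parts_of n | j \in parts lam]
          [seq part_add j mu | mu <- parts_of (n - j)%N].
Proof.
move=> /andP[j0 jn]; apply: uniq_perm.
- by rewrite filter_uniq // fset_uniq.
- by rewrite map_inj_uniq ?fset_uniq //; exact: part_add_inj.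
move=> lam; rewrite mem_filter; apply/andP/mapP => [[jl]|[mu]].
  rewrite mem_parts_of => /eqP ln.
  have jr : 0%N \notin rem j lam by apply/negP => /mem_rem; exact/negP/part0.
  have E : lam = part_add j (mkpart (rem j lam)).
    apply: part_perm_inj; rewrite perm_sym (permPl (part_add_perm _ j0)).
    rewrite perm_sym (permPl (perm_to_rem jl)) perm_cons perm_sym.
    exact: mkpart_perm.
  exists (mkpart (rem j lam)) => //; rewrite mem_parts_of.
  by rewrite -ln {2}E sumn_part_add // addKn.
rewrite !mem_parts_of => /eqP mn ->; rewrite sumn_part_add // mn subnKC //.
by rewrite eqxx (perm_mem (part_add_perm mu j0)) mem_head.
Qed.

(** An absent part contributes [i ^ 0 * 0! = 1], so two partitions can be compared over a common
    list. *)
Lemma zpartE (lam : intpart) (r : seq nat) : uniq r -> {subset parts lam <= r} ->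
  zpart lam = (\prod_(i <- r) (i ^ count_mem i lam * (count_mem i lam)`!))%N.
Proof.
move=> ur lr; rewrite [RHS](bigID (fun i => i \in parts lam)) /=.
rewrite [X in _ = (_ * X)%N]big1 ?muln1 => [|i /count_memPn -> //].
rewrite -[RHS]big_filter; apply: perm_big.
apply: uniq_perm; rewrite ?filter_uniq ?undup_uniq // => i.
by rewrite mem_undup mem_filter; case: (boolP (i \in parts lam)) => // /lr.
Qed.

Lemma zpart_add j mu : (0 < j)%N ->
  zpart (part_add j mu) = (j * (count_mem j mu).+1 * zpart mu)%N.
Proof.
move=> j0; have pe := part_add_perm mu j0.
have ct i : count_mem i (part_add j mu) = ((j == i) + count_mem i mu)%N.
  by rewrite (permP pe).
rewrite (@zpartE _ (undup (j :: mu))) ?undup_uniq //; last first.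
  by move=> i; rewrite mem_undup (perm_mem pe).
rewrite (@zpartE mu (undup (j :: mu))) ?undup_uniq //; last first.
  by move=> i im; rewrite mem_undup inE im orbT.
have jr : j \in undup (j :: mu) by rewrite mem_undup mem_head.
rewrite !(bigD1_seq j) ?undup_uniq //= ct eqxx add1n expnS factS [RHS]mulnA.
congr (_ * _)%N; first by rewrite mulnACA.
by apply: eq_bigr => i ij; rewrite ct eq_sym (negPf ij).
Qed.

Lemma sumn_count (s : seq nat) n : 0%N \notin s -> (sumn s <= n)%N ->
  (\sum_(k < n) k.+1 * count_mem k.+1 s)%N = sumn s.
Proof.
elim: s => [|i s IH] /=; first by move=> _ _; rewrite big1 // => k _; rewrite muln0.
rewrite inE negb_or eq_sym => /andP[i0 s0] sn.
rewrite -IH // ?(leq_trans _ sn) ?leq_addl //.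
case: i i0 sn => // i _ sn.
have iN : (i < n)%N by apply: leq_trans sn; exact: leq_addr.
under eq_bigr do rewrite mulnDr.
rewrite big_split /= (bigD1 (Ordinal iN)) //= eqxx muln1 big1 ?addn0 // => k ki.
suff -> : (i.+1 == k.+1) = false by rewrite muln0.
by apply: contraNF ki => /eqP [ik]; apply/eqP/val_inj.
Qed.

Section PowerSumExpansion.
Variables (K : fieldType) (charK : [pchar K] =i pred0).
Implicit Types (b : nat -> K) (lam mu : intpart).

Lemma zpart_neq0 lam : (zpart lam)%:R != 0 :> K.
Proof.
rewrite natr_neq0 // /zpart big_seq prodn_cond_gt0 // => i.
by rewrite mem_undup => /part_pos i0; rewrite muln_gt0 expn_gt0 i0 fact_gt0.
Qed.

Lemma psym_part_add j mu : (0 < j)%N ->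
  psym_part K (part_add j mu) = psym K j * psym_part K mu.
Proof.
by move=> j0; rewrite /psym_part (perm_big _ (part_add_perm mu j0)) big_cons.
Qed.

Definition powersum_poly b n : xps K := \sum_(lam <- parts_of n)
  ((zpart lam)%:R^-1 * \prod_(i <- lam) b i) *: psym_part K lam.

Lemma powersum_poly0 b : powersum_poly b 0 = 1.
Proof.
have p0 : perm_eq (parts_of 0) [:: mkpart [::]].
  apply: uniq_perm; rewrite ?fset_uniq // => lam.
  rewrite mem_parts_of inE; apply/eqP/eqP => [l0|-> //].
  rewrite -[LHS]mkpartK; congr mkpart; apply/nilP; rewrite /nilp -leqn0 -l0.
  exact: size_part.
rewrite /powersum_poly (perm_big _ p0) big_seq1 /psym_part /zpart /= !big_nil.
by rewrite mulr1 invr1 scale1r.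
Qed.

(** The factor [n] is split as the sum of [k * m_k] over the distinct parts [k] of [lam]. Removing
    one [k] leaves [mu], and [k * m_k / z_lam = 1 / z_mu]. *)
Lemma newton_rec_powersum b :
  newton_rec (fun n => b n *: psym K n) (powersum_poly b).
Proof.
move=> n; pose B lam := \prod_(i <- parts lam) b i.
transitivity (\sum_(lam <- parts_of n) \sum_(k < n | k.+1 \in parts lam)
    ((k.+1 * count_mem k.+1 lam)%:R * ((zpart lam)%:R^-1 * B lam)) *: psym_part K lam).
  rewrite scaler_sumr [LHS]big_seq [RHS]big_seq; apply: eq_bigr => lam.
  rewrite mem_parts_of => /eqP ln; rewrite -scaler_suml scalerA; congr (_ *: _).
  rewrite -mulr_suml; congr (_ * _).
  rewrite -natr_sum -{1}ln -(@sumn_count lam n) ?part0 ?ln //; congr _%:R.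
  rewrite [RHS]big_mkcond; apply: eq_bigr => k _.
  by case: (boolP (_ \in _)) => // /count_memPn ->; rewrite muln0.
rewrite (exchange_big_dep xpredT) //=; apply: eq_bigr => k _.
rewrite -big_filter (perm_big _ (@perm_parts_add n k.+1 _)) ?ltn_ord //.
rewrite big_map mulr_sumr; apply: eq_bigr => mu _.
rewrite psym_part_add // -scalerAr -scalerAl scalerA; congr (_ *: _).
rewrite /B (perm_big _ (@part_add_perm k.+1 mu _)) //= big_cons.
rewrite zpart_add // (permP (@part_add_perm k.+1 mu _)) //= eqxx add1n.
set z := zpart mu; set w := (k.+1 * _)%N; rewrite natrM invfM !mulrA.
rewrite divff ?mul1r; last by rewrite natr_neq0 // muln_gt0.
by rewrite mulrAC.
Qed.

Lemma powersum_expansionP (R : nat -> xps K) b : R 0%N = 1 ->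
  powersum_expansion R b <-> newton_rec (fun n => b n *: psym K n) R.
Proof.
move=> R0.
have E n : \sum_(lam \in [set lam : intpart | sumn lam = n]%classic)
    ((zpart lam)%:R^-1 * \prod_(i <- lam) b i) *: psym_part K lam =
    powersum_poly b n.
  by rewrite fsbig_finite //; exact: finite_part.
have nS := newton_rec_powersum b.
split=> [H|nR n _].
  suff -> : R = powersum_poly b by [].
  by apply: funext => -[|n]; rewrite ?R0 ?powersum_poly0 // H // E.
rewrite E; apply: (newton_rec_uniqr charK _ nR nS).
by rewrite R0 powersum_poly0.
Qed.

End PowerSumExpansion.

(** * The internal product *)

Definition part_union (mu nu : intpart) : intpart := mkpart (mu ++ nu).

Lemma part_union_perm mu nu : perm_eq (part_union mu nu) (mu ++ nu).
Proof. by apply: mkpart_perm; rewrite mem_cat negb_or !part0. Qed.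

Lemma sumn_part_union mu nu : sumn (part_union mu nu) = (sumn mu + sumn nu)%N.
Proof. by rewrite (perm_sumn (part_union_perm mu nu)) sumn_cat. Qed.

Section InternalProduct.
Variables (K : fieldType) (charK : [pchar K] =i pred0).
Implicit Types (f g : xps K) (c d : intpart -> K) (lam mu nu : intpart).

Lemma psym_part_union mu nu :
  psym_part K (part_union mu nu) = psym_part K mu * psym_part K nu.
Proof. by rewrite /psym_part (perm_big _ (part_union_perm mu nu)) big_cat. Qed.

(** Convolution over unions of multisets. The range is finite and contains every pair with union
    [lam], since both members have size at most [sumn lam]. *)
Definition part_conv c d lam : K :=
  \sum_(mu <- parts_le (sumn lam)) \sum_(nu <- parts_le (sumn lam))
    if part_union mu nu == lam then c mu * d nu else 0.

(** For the coefficient of [m] both series can be cut off at degree [mdeg m]; the finite sums are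
    then multiplied out. *)
Lemma psym_seriesM c d :
  psym_series c * psym_series d = psym_series (part_conv c d).
Proof.
apply: xpsP => m; set N := mdeg m.
pose tr (c : intpart -> K) := \sum_(lam <- parts_le N) c lam *: psym_part K lam.
have trE (e : intpart -> K) (m' : {cmonom nat}) : (mdeg m' <= N)%N ->
    xcoef (psym_series e) m' = xcoef (tr e) m'.
  move=> mN; rewrite xcoef_sum; apply: xcoef_psym_series => lam ld.
  by rewrite mem_parts_le ld.
rewrite (@eq_xcoefM _ _ (tr c) _ (tr d)); last first.
  move=> d1 d2 dm; rewrite !trE // /N -dm mdegM ?leq_addr //.
  exact: leq_addl.
rewrite mulr_suml xcoef_sum xcoef_psym_series_of -/N.
transitivity (\sum_(mu <- parts_le N) \sum_(nu <- parts_le N)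
    c mu * d nu * xcoef (psym_part K (part_union mu nu)) m).
  apply: eq_bigr => mu _; rewrite mulr_sumr xcoef_sum; apply: eq_bigr => nu _.
  by rewrite psym_part_union -scalerAr -scalerAl scalerA mulrC.
transitivity (\sum_(mu <- parts_le N) \sum_(nu <- parts_le N)
    \sum_(lam <- parts_of N)
    (if part_union mu nu == lam then c mu * d nu else 0) *
    xcoef (psym_part K lam) m).
  apply: eq_bigr => mu _; apply: eq_bigr => nu _.
  have [E|ne] := eqVneq (sumn (part_union mu nu)) N.
    rewrite (bigD1_seq (part_union mu nu)) ?fset_uniq ?mem_parts_of ?E //=.
    rewrite eqxx big1 ?addr0 // => lam; rewrite eq_sym => /negPf ->.
    by rewrite mul0r.
  rewrite big_seq big1 => [|lam].
    apply/eqP; rewrite mulf_eq0; apply/orP; right.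
    by apply: contraNT ne => /psym_part_supp[<-].
  rewrite mem_parts_of => /eqP lN.
  case: (part_union mu nu =P lam) => [E|_]; last by rewrite mul0r.
  by rewrite E lN eqxx in ne.
under eq_bigr do rewrite exchange_big /=.
rewrite exchange_big /= [LHS]big_seq [RHS]big_seq; apply: eq_bigr => lam.
rewrite mem_parts_of => /eqP lN; rewrite /part_conv lN mulr_suml.
by apply: eq_bigr => mu _; rewrite mulr_suml.
Qed.

Lemma psym_series_sum n (c : nat -> intpart -> K) :
  \sum_(j < n) psym_series (c j) = psym_series (fun lam => \sum_(j < n) c j lam).
Proof.
apply: xpsP => m; rewrite xcoef_sum xcoef_psym_series_of.
transitivity (\sum_(j < n) \sum_(lam <- parts_of (mdeg m))
    c j lam * xcoef (psym_part K lam) m).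
  by apply: eq_bigr => j _; rewrite xcoef_psym_series_of.
by rewrite exchange_big; apply: eq_bigr => lam _; rewrite mulr_suml.
Qed.

Lemma psym_series_delta c mu :
  psym_series (fun lam => c lam * (lam == mu)%:R) = c mu *: psym_part K mu.
Proof.
apply: xpsP => m; rewrite xcoefZ.
rewrite (@xcoef_psym_series _ _ _ (mu |` parts_of (mdeg m))%fset); last first.
  by move=> lam ld; rewrite in_fset1U mem_parts_of ld eqxx orbT.
rewrite (bigD1_seq mu) ?fset_uniq ?in_fset1U ?eqxx //= mulr1 big1 ?addr0 //.
by move=> lam /negPf ->; rewrite mulr0 mul0r.
Qed.

Lemma psym_part_series mu :
  psym_part K mu = psym_series (fun lam => (lam == mu)%:R).
Proof.
rewrite -[LHS]scale1r -(psym_series_delta (fun=> 1)); congr psym_series.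
by apply: funext => lam; rewrite mul1r.
Qed.

Lemma psym_coord_part mu : psym_coord (psym_part K mu) = fun lam => (lam == mu)%:R.
Proof. by rewrite psym_part_series psym_seriesK. Qed.

Lemma psym_part_nil : psym_part K (mkpart [::]) = 1.
Proof. by rewrite /psym_part big_nil. Qed.

Lemma intprodC f g : intprod f g = intprod g f.
Proof. by congr psym_series; apply: funext => lam; rewrite mulrAC. Qed.

Lemma tintprodC (A : tps (xps K)) f : tintprodr f A = tintprodl A f.
Proof. by apply: tpsP => n; exact: intprodC. Qed.

Lemma intprod_part f mu : intprod f (psym_part K mu) =
  ((zpart mu)%:R * psym_coord f mu) *: psym_part K mu.
Proof.
rewrite /intprod psym_coord_part.
exact: (psym_series_delta (fun lam => (zpart lam)%:R * psym_coord f lam)).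
Qed.

Lemma intprod_linear f (a : K) g h : symmetric_series g -> symmetric_series h ->
  intprod f (a *: g + h) = a *: intprod f g + intprod f h.
Proof.
move=> gs hs; rewrite /intprod -psym_seriesZ -psym_seriesD; congr psym_series.
rewrite -{1}(psym_coordK charK gs) -{1}(psym_coordK charK hs).
rewrite -psym_seriesZ -psym_seriesD psym_seriesK //; apply: funext => lam.
by rewrite mulrDr mulrCA.
Qed.

(** Restricting the coordinates to partitions of [n] does not change the series, so uniqueness of
    coordinates applies. *)
Lemma psym_coord_homogeneous n f lam : symmetric_series f -> homogeneous n f ->
  sumn lam != n -> psym_coord f lam = 0.
Proof.
move=> fs fh ln; pose c lam := if sumn lam == n then psym_coord f lam else 0.
have -> : f = psym_series c; last by rewrite psym_seriesK // /c (negPf ln).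
apply: xpsP => m; have [E|ne] := eqVneq (mdeg m) n.
  rewrite -{1}(psym_coordK charK fs) !xcoef_psym_series_of.
  rewrite [LHS]big_seq [RHS]big_seq; apply: eq_bigr => mu.
  by rewrite mem_parts_of /c -E => ->.
rewrite xcoef_psym_series_of big_seq big1 => [|mu].
  by apply/eqP; apply: contraNT ne => /fh ->.
by rewrite mem_parts_of /c => /eqP ->; rewrite (negPf ne) mul0r.
Qed.

Lemma psym_coord_powersum b n lam : psym_coord (powersum_poly b n) lam =
  if sumn lam == n then (zpart lam)%:R^-1 * \prod_(i <- lam) b i else 0 :> K.
Proof.
pose c mu : K := (zpart mu)%:R^-1 * \prod_(i <- mu) b i.
have -> : powersum_poly b n =
    psym_series (fun mu => if sumn mu == n then c mu else 0).
  apply: xpsP => m; rewrite xcoef_sum.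
  rewrite (@xcoef_psym_series _ _ _ (parts_of (mdeg m) `|` parts_of n)%fset).
    rewrite [RHS](bigID (fun mu => mu \in parts_of n)) /=.
    rewrite [X in _ = _ + X]big1 ?addr0 => [|mu]; last first.
      by rewrite mem_parts_of => /negPf ->; rewrite mul0r.
    rewrite -[RHS]big_filter [RHS](perm_big (parts_of n)) /=.
      rewrite [LHS]big_seq [RHS]big_seq; apply: eq_bigr => mu.
      by rewrite mem_parts_of => ->.
    apply: uniq_perm; rewrite ?filter_uniq ?fset_uniq // => mu.
    by rewrite mem_filter in_fsetU orbC; case: (mu \in parts_of n).
  by move=> mu md; rewrite in_fsetU !mem_parts_of md eqxx.
by rewrite psym_seriesK.
Qed.

(* Each p_lam is an eigenvector of the internal product by R_|lam|, with an
   eigenvalue multiplicative in lam. *)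
Lemma tintprod_powersumM b f g : symmetric_series f -> symmetric_series g ->
  tintprodl (TPS (powersum_poly b)) (f * g) =
  tintprodl (TPS (powersum_poly b)) f * tintprodl (TPS (powersum_poly b)) g.
Proof.
pose B lam : K := \prod_(i <- parts lam) b i.
have ipE n c : intprod (powersum_poly b n) (psym_series c) =
    psym_series (fun lam => if sumn lam == n then B lam * c lam else 0).
  rewrite /intprod psym_seriesK //; congr psym_series; apply: funext => lam.
  rewrite psym_coord_powersum; case: eqP => _; last by rewrite mulr0 mul0r.
  by rewrite mulVKf ?zpart_neq0.
move=> /(psym_coordK charK) <- /(psym_coordK charK) <-.
move: (psym_coord f) (psym_coord g) => c d.
apply: tpsP => n; rewrite tcoefM psym_seriesM [LHS]/= ipE.
pose C (j : nat) := part_conv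
  (fun lam => if sumn lam == j then B lam * c lam else 0)
  (fun lam => if sumn lam == (n - j)%N then B lam * d lam else 0).
transitivity (\sum_(j < n.+1) psym_series (C j)); last first.
  by apply: eq_bigr => j _; rewrite -psym_seriesM -!ipE.
rewrite (psym_series_sum n.+1 C); congr psym_series; apply: funext => lam.
rewrite /C /part_conv [RHS]exchange_big /=.
transitivity (\sum_(mu <- parts_le (sumn lam)) \sum_(nu <- parts_le (sumn lam))
  if sumn lam == n then
    if part_union mu nu == lam then B lam * (c mu * d nu) else 0 else 0).
  case: eqP => _.
    rewrite mulr_sumr; apply: eq_bigr => mu _; rewrite mulr_sumr.
    by apply: eq_bigr => nu _; case: (_ =P lam) => // _; rewrite mulr0.
  by rewrite big1 // => mu _; rewrite big1.
apply: eq_bigr => mu _; rewrite [RHS]exchange_big /=; apply: eq_bigr => nu _.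
case: (_ =P lam) => [<-|_]; last by rewrite if_same big1.
rewrite sumn_part_union.
have -> : B (part_union mu nu) = B mu * B nu.
  by rewrite /B (perm_big _ (part_union_perm mu nu)) big_cat.
(* A summand survives only for [j = sumn mu], and then [n - j = sumn nu]. *)
case: eqP => [<-|ne].
  rewrite (bigD1 (Ordinal (leq_addr (sumn nu) (sumn mu) : (_ < _.+1)%N))) //=.
  rewrite addKn !eqxx mulrACA big1 ?addr0 // => j jm.
  rewrite ifF ?mul0r //; apply: contraNF jm => /eqP E.
  by apply/eqP/val_inj.
rewrite big1 // => j _; case: eqP => [mj|]; last by rewrite mul0r.
case: eqP => [nj|]; last by rewrite mulr0.
by case: ne; rewrite mj nj subnKC // -ltnS.
Qed.

(** Testing multiplicativity on [p_mu] and [p_nu] shows that the eigenvalues [w] are multiplicative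
    in the partition. *)
Lemma tintprod_mul_powersum (R : nat -> xps K) : R 0%N = 1 ->
  (forall n, symmetric_series (R n)) -> (forall n, homogeneous n (R n)) ->
  (forall f g, symmetric_series f -> symmetric_series g ->
     tintprodl (TPS R) (f * g) = tintprodl (TPS R) f * tintprodl (TPS R) g) ->
  exists b, R = powersum_poly b.
Proof.
move=> R0 Rs Rh RM.
(* [w lam] is the eigenvalue of [p_lam] under [R_|lam|]; by homogeneity every other [R_n]
   annihilates [p_lam]. *)
pose w lam : K := (zpart lam)%:R * psym_coord (R (sumn lam)) lam.
have RE n lam : intprod (R n) (psym_part K lam) =
    if sumn lam == n then w lam *: psym_part K lam else 0.
  rewrite intprod_part /w; case: eqP => [->//|/eqP ne].
  by rewrite (psym_coord_homogeneous (Rs n) (Rh n)) // mulr0 scale0r.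
have wM mu nu : w (part_union mu nu) = w mu * w nu.
  suff E : w (part_union mu nu) *: psym_part K (part_union mu nu) =
      (w mu * w nu) *: psym_part K (part_union mu nu).
    apply/eqP; rewrite -subr_eq0.
    have /eqP := E; rewrite -subr_eq0 -scalerBl scaler_eq0.
    by rewrite (negPf (psym_part_neq0 charK _)) orbF.
  have := RM (psym_part K mu) (psym_part K nu)
    (@psym_part_sym _ _) (@psym_part_sym _ _).
  move=> /(congr1 (fun A => tcoef A (sumn mu + sumn nu)%N)).
  rewrite tcoefM -psym_part_union /= RE sumn_part_union eqxx => ->.
  rewrite (bigD1 (Ordinal (leq_addr (sumn nu) (sumn mu) : (_ < _.+1)%N))) //=.
  rewrite big1 ?addr0 => [|j jm].
    rewrite !RE addKn !eqxx psym_part_union -scalerAl -scalerAr scalerA.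
    by [].
  rewrite RE ifF ?mul0r //; apply: contraNF jm => /eqP E.
  by apply/eqP/val_inj.
have w1 : w (mkpart [::]) = 1.
  rewrite /w /= R0 -psym_part_nil psym_coord_part eqxx mulr1.
  by rewrite /zpart big_nil.
pose b i := w (mkpart [:: i]).
have wE lam : w lam = \prod_(i <- lam) b i.
  (* Passing to [mkpart] of a list permits induction on the list, peeling off one part at a time. *)
  rewrite -{1}[lam]mkpartK; elim: (parts lam) (part0 lam) => [|i s IH].
    by rewrite big_nil w1.
  rewrite inE negb_or big_cons => /andP[i0 s0]; rewrite -IH // -wM; congr w.
  apply: part_perm_inj; rewrite (permPl (mkpart_perm _)) ?inE ?negb_or ?i0 //.
  rewrite perm_sym (permPl (part_union_perm _ _)) -[i :: s]cat1s.
  by apply: perm_cat; rewrite mkpart_perm // inE.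
exists b; apply: funext => n; rewrite -(psym_coordK charK (Rs n)).
have ps : symmetric_series (powersum_poly b n).
  move=> h bh m m' mm'; rewrite !xcoef_sum; apply: eq_bigr => lam _.
  by rewrite !xcoefZ (@psym_part_sym _ lam _ bh _ _ mm').
rewrite -[RHS](psym_coordK charK ps); congr psym_series; apply: funext => lam.
rewrite psym_coord_powersum -wE; case: eqP => [<-|/eqP ne].
  by rewrite /w mulKf ?zpart_neq0.
exact: (psym_coord_homogeneous (Rs n) (Rh n)).
Qed.

End InternalProduct.

(** * The theorem *)

Section Equivalences.
Variables (K : fieldType) (charK : [pchar K] =i pred0) (R : nat -> xps K).
Hypothesis R0 : R 0%N = 1.

Lemma log_expansionP b : log_expansion (TPS R) b <->
  newton_rec (fun n => b n *: psym K n) R.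
Proof. exact: (tlogP charK (A := TPS R)). Qed.

(** Restriction to [x_0] gives one direction and [newton_rec_mult] the other. This yields the
    relation between the constants [b] and the seed. *)
Lemma newton_rec_multP (F : nat -> K) b : F 0%N = 1 ->
  (forall n, R n = mult_series F n) ->
  newton_rec (fun n => b n *: psym K n) R <->
  tlog (TPS (R := K^o) F) = divn_series (R := K^o) b.
Proof.
move=> F0 RF; rewrite (tlogP charK (A := TPS (R := K^o) F)) //.
have {}RF : R = mult_series F by apply: funext.
split=> [/newton_rec_psym_pcm|/(newton_rec_mult F0)]; last by rewrite -RF.
suff -> : (fun n => xcoef (R n) (pcm 0 n)) = F by [].
by apply: funext => n; rewrite RF xcoef_mult_pcm.
Qed.

Lemma mult_newton_rec (F : nat -> K) : F 0%N = 1 ->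
  (forall n, R n = mult_series F n) ->
  exists b, newton_rec (fun n => b n *: psym K n) R.
Proof.
move=> F0 RF; pose l : nat -> K := tcoef (tlog (TPS (R := K^o) F)).
exists (fun n => n%:R * l n); apply/(newton_rec_multP _ F0 RF).
apply: tpsP => -[|n]; first by rewrite /= big_geq.
by rewrite -[RHS]/(n.+1%:R^-1 * (n.+1%:R * l n.+1)) mulKf ?natr_neq0.
Qed.

(** The seed is read off from the powers of [x_0] in [R]. Both [R] and the series it generates
    satisfy the same recursion with the same start. *)
Lemma newton_rec_mult_exists b : newton_rec (fun n => b n *: psym K n) R ->
  exists F, F 0%N = 1 /\ forall n, R n = mult_series F n.
Proof.
move=> nR; have F0 : xcoef (R 0) (pcm 0 0) = 1.
  by rewrite R0 -(mult_series0 (fun=> 1)) xcoef_mult_pcm.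
exists (fun n => xcoef (R n) (pcm 0 n)); split=> //.
apply: (newton_rec_uniqr charK _ nR); first by rewrite R0 mult_series0.
exact/newton_rec_mult/newton_rec_psym_pcm.
Qed.

End Equivalences.

Theorem theorem2p1 (K : fieldType) (charK : [pchar K] =i pred0)
    (R : nat -> xps K) (R0 : R 0%N = 1)
    (Rsym : forall n, symmetric_function (R n))
    (Rhom : forall n, homogeneous n (R n)) :
  let A : tps (xps K) := TPS R in
  [<-> (* a *) exists F : tps K^o, is_seed F A;
       (* b *) exists b : nat -> K, log_expansion A b;
       (* c *) exists a : nat -> K, monomial_expansion R a;
       (* d *) exists b : nat -> K, powersum_expansion R b;
       (* e *) forall f g : xps K, symmetric_series f -> symmetric_series g ->
                 tintprodl A (f * g) = tintprodl A f * tintprodl A g;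
       (* e, second form *) sym_alg_morphism (fun f => tintprodr f A)]
  /\
  (forall F : tps K^o, is_seed F A ->
     [/\ forall a : nat -> K, monomial_expansion R a <-> F = TPS (R := K^o) a,
         forall b : nat -> K,
           log_expansion A b <-> tlog F = divn_series (R := K^o) b
       & forall b : nat -> K,
           powersum_expansion R b <-> tlog F = divn_series (R := K^o) b]).
Proof.
have Rs n : symmetric_series (R n) by case: (Rsym n).
have logP := log_expansionP charK R0.
have psP b := powersum_expansionP charK b R0.
have eA : (forall f g : xps K, symmetric_series f -> symmetric_series g ->
    tintprodl (TPS R) (f * g) = tintprodl (TPS R) f * tintprodl (TPS R) g) ->
    exists b, powersum_expansion R b.
  move=> /(tintprod_mul_powersum charK R0 Rs Rhom)[b Rb]; exists b.
  by apply/psP; rewrite Rb; exact: newton_rec_powersum.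
(* The six statements form one cycle; apart from the passage between the two forms of (e), each
   implication goes through Newton's recursion. *)
split; first tfae.
- move=> [F /is_seedP[F0 RF]].
  by have [b /logP nb] := mult_newton_rec charK F0 RF; exists b.
- move=> [b /logP /(newton_rec_mult_exists charK R0)[a aP]].
  by exists a; apply/monomial_expansionP.
- move=> [a /(monomial_expansionP _ R0)[a0 Ra]].
  by have [b /psP nb] := mult_newton_rec charK a0 Ra; exists b.
- move=> [b /psP nb] f g.
  suff -> : R = powersum_poly b by exact: tintprod_powersumM.
  apply: funext; apply: (newton_rec_uniqr charK _ nb).
    by rewrite R0 powersum_poly0.
  exact: newton_rec_powersum.
- move=> RM; split.
  (* Here [1] is the power sum of the empty partition, and for [n > 0] the corresponding coordinate
     of [R n] vanishes by homogeneity. *)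
  + apply: tpsP => n; rewrite tintprodC [LHS]/= -psym_part_nil intprod_part //.
    case: n => [|n]; last first.
      by rewrite (psym_coord_homogeneous charK (Rs n.+1) (Rhom n.+1)) // mulr0 scale0r.
    rewrite R0 -psym_part_nil psym_coord_part // eqxx mulr1.
    by rewrite /zpart big_nil scale1r psym_part_nil.
  + move=> c f g fs gs; rewrite !tintprodC; apply: tpsP => n.
    exact: intprod_linear.
  by move=> f g fs gs; rewrite !tintprodC; exact: RM.
- move=> [_ _ RM]; have [|b] := eA.
    by move=> f g fs gs; rewrite -!tintprodC; exact: RM.
  move=> /psP /(newton_rec_mult_exists charK R0)[a aP].
  by exists (TPS (R := K^o) a); apply/is_seedP.
move=> F /is_seedP[F0 RF]; have FE : F = TPS (R := K^o) (tcoef F) by case: F {F0 RF}.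
split=> [a|b|b].
- split=> [/(monomial_expansionP _ R0)[a0 Ra]|Fa].
    apply: tpsP => n /=.
    by rewrite -(xcoef_mult_pcm n a0) -Ra RF xcoef_mult_pcm.
  by apply/(monomial_expansionP _ R0); split; [move: F0|move: RF]; rewrite Fa.
- by rewrite logP {1}FE; exact: newton_rec_multP.
- by rewrite psP {1}FE; exact: newton_rec_multP.
Qed.
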